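(* The conjecture of Kac and Thompson that $\sum_{r\ge1} r\,J(r)<\infty$ is a necessary and sufficient condition for absence of phase transitions in long-range ferromagnetic Ising models is false on the half-line $\mathbb{L}=\mathbb{Z}^-=\{\ldots,-2,-1,0\}$. Specifically, let $a>0$ and consider the Ising LSS $f^{\beta}$ on $\Omega=\{-1,1\}^{\mathbb{L}}$ with couplings $J(i,j)=J(|i-j|)$, where $J(r)=a\,(r^2\log r)^{-1}$ for $r\ge2$ and $J(1)\ge0$ is any constant. Then $\sum_{r\ge1} r\,J(r)=\infty$, yet $|\mathcal{G}(f^{\beta})|=1$ for all $\beta>0$.
   Context: $\Omega=\{-1,1\}^{\mathbb{L}}$ carries the product topology and product $\sigma$-algebra $\mathcal F$; $\mathcal{F}_{\le i}$ is generated by coordinates $\le i$. $\omega_k^n=\omega_{[k,n]}$, $\Omega_k^n=\{-1,1\}^{[k,n]}$, $\omega_{-\infty}^n=\omega_{(-\infty,n]}$; juxtaposition denotes concatenation. For symmetric couplings $J(i,j)$, $i\neq j\in\mathbb{L}$, with $\sum_j|J(i,j)|<\infty$ for each $i$, the long-range Ising potential at inverse temperature $\beta$ is $\phi_A(\omega)=-\beta J(i,j)\omega_i\omega_j$ if $A=\{i,j\}$ with $i\neq j$, and $\phi_A=0$ for all other finite $A\subset\mathbb{L}$. The Ising LSS $f^{\beta}=\{f_i\}_{i\in\mathbb{L}}$ is the family of transition probabilities $$f_i(\omega_i\mid\omega_{-\infty}^{i-1})=\frac{\sum_{\sigma_{i+1}^0\in\Omega_{i+1}^0}\exp\big[-\sum_{A\cap[i,0]\neq\emptyset}\phi_A(\sigma_{i+1}^0\,\omega_{-\infty}^i)\big]}{\sum_{\sigma_i^0\in\Omega_i^0}\exp\big[-\sum_{A\cap[i,0]\neq\emptyset}\phi_A(\sigma_i^0\,\omega_{-\infty}^{i-1})\big]}$$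 (sums in the exponents over finite $A\subset\mathbb{L}$; for $i=0$ the numerator has the single term with configuration $\omega$). These determine probability kernels $f_i:\mathcal{F}_{\le i}\times\Omega\to[0,1]$ with $f_i(A\mid\cdot)$ $\mathcal{F}_{\le i-1}$-measurable for $A\in\mathcal{F}_{\le i}$ and $f_i(B\mid\cdot)=\mathbf{1}_B$ for $B\in\mathcal{F}_{\le i-1}$. $\mathcal{G}(f)$ is the set of probability measures $\mu$ on $(\Omega,\mathcal{F})$ with $\mu f_i=\mu$ over $\mathcal{F}_{\le i}$ for every $i\in\mathbb{L}$, where $(\mu f_i)(h)=\int f_i(h\mid\omega)\,\mu(d\omega)$. A phase transition means $|\mathcal{G}(f)|>1$. *)

(* Defs.v *)
(* Sites.  The half-line L = {..., -2, -1, 0} is indexed by nat: the natural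
   number n stands for the site -n.  The order is thus reversed: "the sites
   <= -n" are the k with n <= k, the interval [-n, 0] is {0, ..., n}, and the
   distance |i - j| is unchanged.

   Spins.  {-1, 1} is encoded by bool, see [spin]. *)
From HB Require Import structures.
From mathcomp Require Import all_boot all_order all_algebra finmap.
From mathcomp Require Import all_classical all_reals all_analysis.

Set Implicit Arguments.
Unset Strict Implicit.
Unset Printing Implicit Defensive.

Import Order.TTheory GRing.Theory Num.Theory.
Import numFieldNormedType.Exports.

Local Open Scope classical_set_scope.
Local Open Scope ring_scope.

(* The sigma-algebra F_{<= -n}, generated by the coordinates at the sites
   <= -n. *)
Definition coord_events (n : nat) : set (set (nat -> bool)) :=
  \bigcup_(k in [set k | (n <= k)%N])
    preimage_set_system setT (fun w : nat -> bool => w k) measurable.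

Definition F_le (n : nat) : set (set (nat -> bool)) := <<s coord_events n >>.

(* Omega, with the product sigma-algebra F = F_{<= 0}. *)
Definition config : Type := g_sigma_algebraType (coord_events 0).

Section ising_lss.
Variable R : realType.

Definition spin (b : bool) : R := if b then 1 else -1.

(* Sum of an absolutely summable real family. *)
Definition rsum (T : choiceType) (D : set T) (f : T -> R) : R :=
  fine (\esum_(x in D) (Num.max (f x) 0)%:E)
  - fine (\esum_(x in D) (Num.max (- f x) 0)%:E).

Definition potential : Type := {fset nat} -> config -> R.

(* An enumeration of A = {i, j} with i <> j is a two-element list; for
   symmetric J the value does not depend on the order of enumeration. *)
Definition ising_potential (J : nat -> nat -> R) (beta : R) : potential :=
  fun A w =>
    if enum_fset A is [:: i; j] then - (beta * J i j * spin (w i) * spin (w j))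
    else 0.

(* The concatenation s w of a configuration s on the m sites 0, -1, ..., -(m-1)
   with the restriction of w to the sites <= -m. *)
Definition concat (m : nat) (s : {ffun 'I_m -> bool}) (w : config) : config :=
  fun k => if insub k is Some i then s i else w k.

(* exp[- sum_{A meets [-n, 0]} phi_A(w)] *)
Definition weight (phi : potential) (n : nat) (w : config) : R :=
  expR (- rsum [set A : {fset nat} | exists2 k, k \in A & (k <= n)%N]
            (fun A => phi A w)).

(* The transition probability f_{-n}(w_{-n} | w_{<= -n-1}), as a function of
   the whole configuration w; it depends only on the sites <= -n. *)
Definition transition (phi : potential) (n : nat) (w : config) : R :=
  (\sum_(s : {ffun 'I_n -> bool}) weight phi n (concat s w)) /
  (\sum_(s : {ffun 'I_n.+1 -> bool}) weight phi n (concat s w)).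

Definition set_site (n : nat) (b : bool) (w : config) : config :=
  fun k => if k == n then b else w k.

(* A left-singleton specification: [f n w A] is the kernel f_{-n}(A | w), only
   meaningful for A in F_{<= -n}. *)
Definition lss : Type := nat -> config -> set config -> \bar R.

(* For A in F_{<= -n} the sites > -n of w are irrelevant in \d_, so this is the
   kernel on F_{<= -n} which resamples the spin at -n given the past. *)
Definition lss_kernel (phi : potential) : lss := fun n w A =>
  (\sum_(b : bool) (transition phi n (set_site n b w))%:E
                   * \d_(set_site n b w) A)%E.

Definition ising_lss (J : nat -> nat -> R) (beta : R) : lss :=
  lss_kernel (ising_potential J beta).

(* G(f): mu f_i = mu over F_{<= i} for every site i. *)
Definition lss_states (f : lss) : set (probability config R) :=
  [set mu | forall (n : nat) (A : set config), F_le n A ->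
     (\int[mu]_w f n w A = mu A)%E].

(* Equality of measures as set functions on F: the library's measures are
   total on [set config], with arbitrary values outside F. *)
Definition same_law (mu nu : probability config R) : Prop :=
  forall A : set config, measurable A -> mu A = nu A.

(* |G(f)| = 1 *)
Definition unique_state (f : lss) : Prop :=
  exists2 mu, lss_states f mu & forall nu, lss_states f nu -> same_law mu nu.

(* |G(f)| > 1 *)
Definition phase_transition (f : lss) : Prop :=
  exists mu nu, [/\ lss_states f mu, lss_states f nu & ~ same_law mu nu].

Definition distance_coupling (J : nat -> R) (i j : nat) : R :=
  J `|i%:Z - j%:Z|%N.

(* For ferromagnetic distance-dependent couplings on the half-line: summability
   of r J(r) is equivalent to absence of phase transitions at every inverse
   temperature. *)
Definition kac_thompson_conjecture : Prop :=
  forall J : nat -> R,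
    (forall r, (1 <= r)%N -> 0 <= J r) ->
    (\sum_(1 <= r <oo) (J r)%:E < +oo)%E ->
    ((\sum_(1 <= r <oo) (r%:R * J r)%:E < +oo)%E <->
     forall beta : R, 0 < beta ->
       ~ phase_transition (ising_lss (distance_coupling J) beta)).

End ising_lss.

(* Main.v *)
Require Import Defs.
From HB Require Import structures.
From mathcomp Require Import all_boot all_order all_algebra finmap.
From mathcomp Require Import all_classical all_reals all_analysis.
From mathcomp Require Import measurable_realfun.
From mathcomp Require Import ring lra zify.

Set Implicit Arguments.
Unset Strict Implicit.
Unset Printing Implicit Defensive.

Import Order.TTheory GRing.Theory Num.Theory.
Import numFieldNormedType.Exports.

Local Open Scope classical_set_scope.
Local Open Scope ring_scope.

(** The kernels of the left-singleton specification compose, over the sites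
    0, ..., N-1, to the finite-volume Gibbs distribution of the half-line Ising
    model with the spins beyond N as boundary condition.  Uniqueness is therefore
    the statement that the influence of this boundary condition on a fixed finite
    set of spins vanishes as N grows.

    Two copies of the model, with boundary conditions w and w', are compared.
    Write T_r for the sum of the beta J(s) over s > r.  In the pair of copies the
    interaction of a site i with the sites beyond i + r contributes, after
    normalisation, a factor between exp(-4 T_r) and 1.  The interaction of i with all later sites
    can thus be decomposed according to a random reach: given reach r, the
    interaction involves the sites i, ..., i + r only, and, whatever the spins
    are, the reaches are independent with probability at least exp(-4 T_r) of being
    at most r.  If no reach of the sites below n extends to n or beyond (a cut at
    n), the first n sites of the two copies are decoupled from the rest, and
    exchanging the copies there preserves the weight.  Hence only those choices of
    reaches that have no cut beyond the observed sites contribute to the difference of the two expectations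
    ([replica_bound], [gibbs_boundary]).

    The probability of having no cut is at most what it is for independent
    identically distributed reaches with distribution function r |-> exp(-4 T_r)
    ([reach_domination]).  There the cuts form a renewal process in which n is a
    cut with probability u_n, the product of the exp(-4 T_r) over r < n, so that
    the probability of seeing no cut up to M is at most 1 / (u_0 + ... + u_M)
    ([avoid_renewal]).  Divergence of the series of the u_n, which is Berbee's
    condition, implies uniqueness ([unique_state_of_renewal]).

    For J(r) = a / (r^2 log r) one has r T_r -> 0, so that n u_n is eventually
    nondecreasing and the series diverges like the harmonic one, for every beta;
    on the other hand r J(r) = a / (r log r) is not summable.  This coupling, with
    J(1) = 0, refutes the conjecture.

    The measure-theoretic part works with quasilocal functions, which are those
    uniformly approximable by functions of finitely many spins.  Their Gibbs
    expectations converge to a positive normalised linear functional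
    ([gibbs_cvg]), which is integration against a probability measure
    ([mean_representation]); this measure is a state ([lss_state_of_events]), and
    every state integrates quasilocal functions in the same way
    ([expect_limit]). *)

(** * A renewal bound for independent reaches *)

Section house_of_cards.
Variables (R : realFieldType) (N : nat) (cdf : nat -> R).
Hypothesis cdf0 : cdf 0 = 0.
Hypothesis cdf1 : cdf N.+1 = 1.
Hypothesis cdf_homo : forall r, cdf r <= cdf r.+1.

(** The index of [cdf] is shifted by one: [cdf r.+1] is the probability that the
    reach is at most [r], and reaches are truncated at [N]. *)
Definition reach_mean (f : nat -> R) : R :=
  \sum_(r < N.+1) (cdf r.+1 - cdf r) * f r.

(** Sites are added one at a time.  The state [t] is the number of further sites
    covered by the reaches drawn so far; drawing [r] at the next site turns it
    into [maxn t.-1 r], and a cut occurs when it becomes 0.  [avoid k M t] is the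
    probability that none of the next [M] steps, from the [k]-th on, is a cut. *)
Fixpoint avoid (k M t : nat) : R :=
  if M is M'.+1 then
    reach_mean (fun r => if (maxn t.-1 r == 0%N) && (k <= 1)%N then 0
                         else avoid k.-1 M' (maxn t.-1 r))
  else 1.

(** The probability of a cut after [n] steps from state 0: the [i]-th of the [n]
    reaches must be at most [n - i]. *)
Definition renewal_mass (n : nat) : R := \prod_(r < n) cdf r.+1.

Lemma reach_meanE c d f : reach_mean (fun r => c * f r + d) = c * reach_mean f + d.
Proof.
rewrite /reach_mean.
under eq_bigr => r _ do rewrite mulrDr mulrCA.
rewrite big_split /= -mulr_sumr -mulr_suml; congr (_ + _).
rewrite -(big_mkord xpredT (fun r => cdf r.+1 - cdf r)) telescope_sumr //.
by rewrite cdf0 cdf1 subr0 mul1r.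
Qed.

Lemma reach_mean_cst d : reach_mean (fun=> d) = d.
Proof.
rewrite -[RHS]add0r -[X in X + d](mul0r (reach_mean (fun=> 0))) -reach_meanE.
by apply: eq_bigr => r _; rewrite mul0r add0r.
Qed.

Lemma le_reach_mean f g : (forall r, f r <= g r) -> reach_mean f <= reach_mean g.
Proof. by move=> fg; apply: ler_sum => r _; rewrite ler_wpM2l // subr_ge0. Qed.

Lemma avoid_ge0 k M t : 0 <= avoid k M t.
Proof.
elim: M k t => [|M IH] k t //=.
rewrite -[leLHS](reach_mean_cst 0); apply: le_reach_mean => r.
by case: ifP.
Qed.

Lemma avoid_le1 k M t : avoid k M t <= 1.
Proof.
elim: M k t => [|M IH] k t //=.
rewrite -[leRHS](reach_mean_cst 1); apply: le_reach_mean => r.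
by case: ifP.
Qed.

Lemma avoid_homo k M t t' : (t <= t')%N -> avoid k M t <= avoid k M t'.
Proof.
elim: M k t t' => [|M IH] k t t' tt' //=.
apply: le_reach_mean => r.
have tt1 : (maxn t.-1 r <= maxn t'.-1 r)%N by lia.
have [/andP[t0 ->]|_] := boolP ((maxn t'.-1 r == 0%N) && (k <= 1)%N).
  by rewrite (_ : maxn t.-1 r == 0%N) //; lia.
by case: ifP => // _; [exact: avoid_ge0 | exact: IH].
Qed.

Lemma avoid_antitone M M' k t : (M <= M')%N -> avoid k M' t <= avoid k M t.
Proof.
elim: M M' k t => [|M IH] [|M'] k t //= MM'; first exact: (avoid_le1 k M'.+1).
by apply: le_reach_mean => r; case: ifP => // _; exact: IH.
Qed.

(** If a cut occurs during the [k] steps of waiting, the chain restarts from 0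
    with at least [M - k] steps left. *)
Lemma avoid_wait k M t :
  avoid k M t <= avoid 0 M t + k%:R * avoid 0 (M - k) 0.
Proof.
elim: M k t => [|M IH] k t /=.
  by rewrite lerDl mulr1.
case: k => [|k]; first by rewrite mul0r addr0.
have -> : forall a b, reach_mean a + b = reach_mean (fun r => 1 * a r + b).
  by move=> a b; rewrite reach_meanE mul1r.
apply: le_reach_mean => r; rewrite mul1r andbT subSS.
have q0 : 0 <= k.+1%:R * avoid 0 (M - k) 0 by rewrite mulr_ge0 ?avoid_ge0.
have [/= /eqP ->|/= _] := ifPn (maxn t.-1 r == 0%N).
  rewrite add0r; case: ifP => // _; apply: le_trans (IH _ _) _.
  rewrite -(natr1 k) mulrDl mul1r addrC lerD2l.
  by apply: avoid_antitone; rewrite leq_subr.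
apply: le_trans (IH _ _) _; rewrite lerD2l ler_wpM2r ?avoid_ge0 //.
by rewrite ler_nat.
Qed.

(** From state [t], a cut after [n] steps has probability [renewal_mass n] if
    [t <= n] and 0 otherwise; this is the one-step equation for that formula. *)
Lemma renewal_step n t : (n <= N)%N ->
  reach_mean (fun r => (maxn t.-1 r <= n)%N%:R * renewal_mass n) =
  (t <= n.+1)%N%:R * renewal_mass n.+1.
Proof.
move=> nN; rewrite /reach_mean.
have -> : (t <= n.+1)%N = (t.-1 <= n)%N by lia.
under eq_bigr => r _ do rewrite geq_max -mulnb natrM -mulrA mulrCA.
rewrite -mulr_sumr; congr (_ * _).
rewrite (eq_bigr (fun r : 'I_N.+1 => if (r <= n)%N then
  (cdf r.+1 - cdf r) * renewal_mass n else 0)); last first.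
  by move=> r _; case: ifP => _; rewrite ?mul1r ?mul0r ?mulr0.
rewrite -big_mkcond /= -mulr_suml /renewal_mass big_ord_recr /= mulrC.
congr (_ * _).
rewrite (eq_bigl (fun r : 'I_N.+1 => (r < n.+1)%N)) //.
rewrite -(big_ord_widen N.+1 (fun r => cdf r.+1 - cdf r)) //.
by rewrite -(big_mkord xpredT (fun r => cdf r.+1 - cdf r)) telescope_sumr // cdf0 subr0.
Qed.

Lemma renewal_mass_ge0 n : 0 <= renewal_mass n.
Proof.
have cdf_ge0 r : 0 <= cdf r.
  elim: r => [|r IH]; first by rewrite cdf0.
  exact: le_trans IH (cdf_homo r).
exact: prodr_ge0.
Qed.

(** The last cut before time [M] is at one of the times 1, ..., [M], or there is
    none; these disjoint events have total probability 1, and after a cut the chain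
    avoids further cuts with probability at least [q]. *)
Lemma renewal_bound q M t : 0 <= q ->
  (forall m, (m < M)%N -> q <= avoid 0 m 0) -> (M <= N.+1)%N ->
  avoid 0 M t + q * \sum_(n < M) (t <= n.+1)%N%:R * renewal_mass n.+1 <= 1.
Proof.
move=> q0; elim: M t => [|M IH] t qM MN /=.
  by rewrite big_ord0 mulr0 addr0.
have IHt t' : avoid 0 M t' +
    q * \sum_(n < M) (t' <= n.+1)%N%:R * renewal_mass n.+1 <= 1.
  by apply: IH => [m mM|]; [apply: qM; lia | lia].
under [X in _ + q * X]eq_bigr => n _.
  rewrite -renewal_step; last by have := ltn_ord n; lia.
  over.
rewrite /reach_mean exchange_big /= mulr_sumr -big_split /=.
rewrite -[leRHS](reach_mean_cst 1).
apply: ler_sum => r _; rewrite -mulr_sumr mulrCA -mulrDr.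
rewrite ler_wpM2l ?subr_ge0 //.
rewrite big_ord_recl /= /renewal_mass big_ord0 mulr1 leqn0.
case: eqP => [->|_] /=.
  rewrite add0r mulrDr mulr1; apply: le_trans (IHt 0%N).
  by rewrite lerD2r; exact: qM.
by rewrite add0r; exact: IHt.
Qed.

Lemma avoid_renewal M : (M <= N)%N ->
  avoid 0 M 0 * \sum_(n < M.+1) renewal_mass n <= 1.
Proof.
move=> MN; rewrite big_ord_recl {1}/renewal_mass big_ord0 mulrDr mulr1.
apply: le_trans (renewal_bound (q := avoid 0 M 0) (M := M) 0 _ _ _).
- by rewrite lerD2l; under [in leRHS]eq_bigr => n _ do rewrite leq0n mul1r.
- exact: avoid_ge0.
- by move=> m mM; apply: avoid_antitone; exact: ltnW.
- exact: leqW.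
Qed.

Lemma avoid_le k M : (k <= M)%N -> (M <= N)%N ->
  avoid k M 0 * \sum_(n < (M - k).+1) renewal_mass n <= k.+1%:R.
Proof.
move=> kM MN.
have U0 : 0 <= \sum_(n < (M - k).+1) renewal_mass n.
  by apply: sumr_ge0 => n _; exact: renewal_mass_ge0.
have MkN : (M - k <= N)%N by lia.
apply: le_trans (_ : k.+1%:R * 1 <= _); last by rewrite mulr1.
apply: le_trans (_ : (k.+1%:R * avoid 0 (M - k) 0) *
   \sum_(n < (M - k).+1) renewal_mass n <= _); last first.
  by rewrite -mulrA ler_wpM2l // avoid_renewal.
rewrite ler_wpM2r //; apply: le_trans (avoid_wait k M 0) _.
rewrite -(natr1 k) mulrDl mul1r addrC lerD2l.
by apply: avoid_antitone; rewrite leq_subr.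
Qed.

(** A law whose distribution function lies above [cdf] gives smaller means to
    nondecreasing functions.  The law has total mass [v] here and is given by its
    distribution function [W], with the index shift of [cdf]. *)
Lemma reach_domination (W f : nat -> R) (v : R) :
  W 0 = 0 -> W N.+1 = v -> (forall r, v * cdf r <= W r) ->
  (forall r, f r <= f r.+1) ->
  \sum_(r < N.+1) (W r.+1 - W r) * f r <= v * reach_mean f.
Proof.
move=> W0 W1 Wc fh; rewrite /reach_mean mulr_sumr -subr_le0 -sumrB.
suff H m : \sum_(r < m.+1) ((W r.+1 - W r) * f r - v * ((cdf r.+1 - cdf r) * f r))
    <= (W m.+1 - v * cdf m.+1) * f m.
  by apply: le_trans (H N) _; rewrite W1 cdf1 mulr1 subrr mul0r.
elim: m => [|m IH].
  by rewrite big_ord_recl big_ord0 addr0 W0 cdf0 /=; nra.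
rewrite big_ord_recr /=; have := Wc m.+1; have := fh m; nra.
Qed.

End house_of_cards.

(** * Exchanging two replicas below a cut *)

Section replica_exchange.
Variables (R : realFieldType) (N : nat) (cdf : nat -> R).
Hypothesis cdf0 : cdf 0 = 0.
Hypothesis cdf1 : cdf N.+1 = 1.
Hypothesis cdf_homo : forall r, cdf r <= cdf r.+1.
Variables (S : finType) (swap : nat -> S -> S).
Hypothesis swapK : forall n, involutive (swap n).
(** [V i] is the weight of the interactions of site [i] with later sites, and
    [W i r] the part of it with reach less than [r]; [swap n] exchanges the replicas
    on the first [n] sites. *)
Variables (V : nat -> S -> R) (W : nat -> nat -> S -> R).
Hypothesis W0 : forall i s, W i 0 s = 0.
Hypothesis WV : forall i s, W i N.+1 s = V i s.
Hypothesis W_homo : forall i r s, W i r s <= W i r.+1 s.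
Hypothesis W_cdf : forall i r s, V i s * cdf r <= W i r s.
Hypothesis V_swap : forall n i s, (n <= i < N)%N -> V i (swap n s) = V i s.
Hypothesis W_swap : forall n i r s, (i + r <= n <= N)%N -> W i r (swap n s) = W i r s.
Variables (k : nat) (d : S -> R) (C : R).
Hypothesis d_swap : forall n s, (k <= n <= N)%N -> d (swap n s) = - d s.
Hypothesis d_le : forall s, `|d s| <= C.

Let V_ge0 i s : 0 <= V i s.
Proof.
rewrite -(WV i s) -(W0 i s).
by elim: N.+1 => // n IH; exact: le_trans IH (W_homo _ _ _).
Qed.

(** The sites below [i] have been assigned reaches, whose weight is [Phi] and which
    cover the sites below [i + t]; hence exchanging the replicas on the first [n]
    sites preserves [Phi] as soon as [i + t <= n].  The weight of site [i] is
    expanded over its reach: if this yields a cut at [i.+1] with [k <= i.+1], the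
    exchange there changes the sign of [d] only, and the sum vanishes; otherwise one
    proceeds to [i.+1]. *)
Lemma replica_bound L i t (Phi : S -> R) : (i + L = N)%N -> (forall s, 0 <= Phi s) ->
  (forall n s, (i + t <= n <= N)%N -> Phi (swap n s) = Phi s) ->
  `|\sum_s d s * (Phi s * \prod_(i <= j < N) V j s)| <=
  C * avoid N cdf (k - i) L t * \sum_s (Phi s * \prod_(i <= j < N) V j s).
Proof.
elim: L i t Phi => [|L IH] i t Phi iL Phi0 Phi_swap.
  rewrite addn0 in iL; subst i; rewrite /= mulr1 mulr_sumr.
  apply: le_trans (ler_norm_sum _ _ _) _; apply: ler_sum => s _.
  rewrite big_geq // mulr1 normrM (ger0_norm (Phi0 s)).
  by rewrite ler_wpM2r.
have iN : (i < N)%N by lia.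
pose P s := \prod_(i.+1 <= j < N) V j s.
have P0 s : 0 <= P s by apply: prodr_ge0.
pose w r s := W i r.+1 s - W i r s.
have w0 r s : 0 <= w r s by rewrite subr_ge0.
have VE s : V i s = \sum_(r < N.+1) w r s.
  rewrite /w -(big_mkord xpredT (fun r => W i r.+1 s - W i r s)).
  by rewrite telescope_sumr // W0 WV subr0.
pose f r : R := if (maxn t.-1 r == 0%N) && (k - i <= 1)%N then 0
         else avoid N cdf (k - i).-1 L (maxn t.-1 r).
have C0 (s : S) : 0 <= C by exact: le_trans (normr_ge0 _) (d_le s).
have step (r : 'I_N.+1) :
  `|\sum_s d s * (Phi s * w r s * P s)| <= \sum_s C * f r * (Phi s * w r s * P s).
  have w_swap n s : (i + r < n <= N)%N -> w r (swap n s) = w r s.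
    by move=> ?; rewrite /w !W_swap //; lia.
  rewrite /f; case: ifPn => [/andP[/eqP t0 ki]|_].
    have -> : \sum_s d s * (Phi s * w r s * P s) = 0; last first.
      by rewrite normr0 sumr_ge0 // => s _; rewrite mulr0 mul0r.
    (* A cut: the exchange at [i.+1] turns the sum into its opposite. *)
    set X := LHS; suff XX : X = - X by apply/eqP; rewrite -eqNr -XX.
    rewrite /X [LHS](reindex_inj (inv_inj (swapK i.+1))) /= -sumrN.
    apply: eq_bigr => s _; rewrite d_swap; last lia.
    rewrite Phi_swap; last lia.
    rewrite w_swap; last lia.
    rewrite mulNr; congr (- (_ * (_ * _))).
    by apply: eq_big_nat => j ?; rewrite V_swap //; lia.
  rewrite -subnS -mulr_sumr; apply: IH; first lia.
    by move=> s; rewrite mulr_ge0.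
  move=> n s ?; rewrite Phi_swap; last lia.
  by rewrite w_swap //; lia.
have E (e : S -> R) : \sum_s e s * (Phi s * \prod_(i <= j < N) V j s) =
   \sum_(r < N.+1) \sum_s e s * (Phi s * w r s * P s).
  rewrite exchange_big /=; apply: eq_bigr => s _.
  rewrite big_ltn // VE -/(P s) -mulr_sumr mulr_suml mulr_sumr.
  by congr (_ * _); apply: eq_bigr => r _; rewrite mulrA.
rewrite E; apply: le_trans (ler_norm_sum _ _ _) _.
apply: le_trans (ler_sum _ (fun r _ => step r)) _.
rewrite exchange_big /= mulr_sumr; apply: ler_sum => s _.
rewrite big_ltn // -/(P s).
rewrite (eq_bigr (fun r : 'I_N.+1 => C * (Phi s * P s) * (w r s * f r))); last first.
  by move=> r _; ring.
rewrite -mulr_sumr -/f.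
have -> : forall a, C * a * (Phi s * (V i s * P s)) = C * (Phi s * P s) * (V i s * a).
  by move=> a; ring.
apply: ler_wpM2l; first by rewrite !mulr_ge0 // (C0 s).
apply: (reach_domination cdf0 cdf1 (W := W i ^~ s)) => // r.
rewrite /f; have [/andP[t0 ->]|_] := boolP ((maxn t.-1 r.+1 == 0%N) && (k - i <= 1)%N).
  by rewrite (_ : maxn t.-1 r == 0%N) //; lia.
case: ifP => _; first exact: avoid_ge0.
by apply: avoid_homo => //; lia.
Qed.

Lemma replica_total : (k <= N)%N ->
  `|\sum_s d s * \prod_(i < N) V i s| * \sum_(n < (N - k).+1) renewal_mass cdf n <=
  C * k.+1%:R * \sum_s \prod_(i < N) V i s.
Proof.
move=> kN.
have U0 : 0 <= \sum_(n < (N - k).+1) renewal_mass cdf n.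
  by apply: sumr_ge0 => n _; exact: (renewal_mass_ge0 cdf0 cdf_homo).
have := @replica_bound N 0 0 (fun=> 1) (add0n N) (fun=> ler01) (fun _ _ _ => erefl).
have -> : \sum_s d s * (1 * \prod_(0 <= j < N) V j s) = \sum_s d s * \prod_(i < N) V i s.
  by apply: eq_bigr => s _; rewrite mul1r big_mkord.
have -> : \sum_s 1 * \prod_(0 <= j < N) V j s = \sum_s \prod_(i < N) V i s.
  by apply: eq_bigr => s _; rewrite mul1r big_mkord.
rewrite subn0 => /(ler_wpM2r U0) H; apply: le_trans H _.
set Z := \sum_s _; have Z0 : 0 <= Z by apply: sumr_ge0 => s _; apply: prodr_ge0.
have [s _|S0] := pickP (fun s : S => true); last first.
  by rewrite /Z big_pred0 ?mulr0 ?mul0r.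
have C0 : 0 <= C by exact: le_trans (normr_ge0 _) (d_le s).
rewrite -!mulrA ler_wpM2l // [Z * _]mulrC mulrA ler_wpM2r //.
exact: (@avoid_le R N cdf).
Qed.
End replica_exchange.

(** * Finite-volume Gibbs distributions and their boundary conditions *)

Definition agree (P : nat -> bool) (w w' : config) : Prop :=
  forall k, P k -> w k = w' k.

Lemma concat_lt n (s : {ffun 'I_n -> bool}) w k (kn : (k < n)%N) :
  concat s w k = s (Ordinal kn).
Proof. by rewrite /concat insubT. Qed.

Lemma concat_ge n (s : {ffun 'I_n -> bool}) w k : (n <= k)%N -> concat s w k = w k.
Proof. by move=> nk; rewrite /concat insubF // ltnNge nk. Qed.

(** [h i] is the logarithm of the weight of the interactions of site [i] with all
    later sites; it is the limit of the [pair_energy i r], up to an error [T r], the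
    tail of the couplings [K] beyond distance [r]. *)
Section gibbs.
Variables (R : realType) (K T : nat -> R) (h : nat -> config -> R).

Definition pair_energy (i r : nat) (w : config) : R :=
  \sum_(q < r) K q.+1 * (spin R (w i) * spin R (w (i + q.+1)%N)).

Hypothesis K_ge0 : forall r, 0 <= K r.+1.
Hypothesis T_rec : forall r, T r = K r.+1 + T r.+1.
Hypothesis T_cvg : T @ \oo --> (0 : R).
Hypothesis h_tail : forall i r w, `|h i w - pair_energy i r w| <= T r.

Lemma norm_spin2 (b c : bool) : `|spin R b * spin R c| = 1.
Proof. by case: b; case: c; rewrite /= ?mulrN1 ?mulr1 ?opprK ?normrN normr1. Qed.

Lemma K_spin_ge r b c : - K r.+1 <= K r.+1 * (spin R b * spin R c).
Proof.
have : `|spin R b * spin R c| <= 1 by rewrite norm_spin2.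
rewrite ler_norml => /andP[bc _].
by rewrite -mulrN1 ler_wpM2l.
Qed.

Lemma T_ge0 r : 0 <= T r.
Proof. exact: le_trans (normr_ge0 _) (h_tail 0 r (fun=> true)). Qed.

Lemma pair_energy_agree i r w w' :
  agree (fun k => i <= k <= i + r)%N w w' -> pair_energy i r w = pair_energy i r w'.
Proof.
by move=> ww'; apply: eq_bigr => -[q qr] _ /=; rewrite !ww' //; lia.
Qed.

Lemma h_agree i r w w' :
  agree (fun k => i <= k <= i + r)%N w w' -> `|h i w - h i w'| <= 2 * T r.
Proof.
move=> ww'; have := h_tail i r w; have := h_tail i r w'.
by rewrite (pair_energy_agree ww') !ler_norml => /andP[? ?] /andP[? ?]; apply/andP; lra.
Qed.

(** [h i] is a uniform limit of functions of the spins at [i], ..., [i + r]. *)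
Lemma h_past i w w' : agree (fun k => i <= k)%N w w' -> h i w = h i w'.
Proof.
move=> ww'; apply/eqP; rewrite -subr_eq0 -normr_le0; apply/ler_addgt0Pr => e e0.
have /cvgrPdist_lt/(_ (e / 2)) [] := T_cvg; first by rewrite divr_gt0.
move=> r _ /(_ r (leqnn r)) /=; rewrite sub0r normrN ger0_norm ?T_ge0 // => Tr.
have /h_agree H : agree (fun k => i <= k <= i + r)%N w w'.
  by move=> k /andP[? _]; exact: ww'.
by rewrite add0r; apply: le_trans H _; lra.
Qed.

Definition gibbs_weight (n : nat) (w : config) : R := expR (\sum_(i < n) h i w).

Definition partition_function (n : nat) (w : config) : R :=
  \sum_(s : {ffun 'I_n -> bool}) gibbs_weight n (concat s w).

Definition gibbs (n : nat) (phi : config -> R) (w : config) : R :=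
  (\sum_(s : {ffun 'I_n -> bool}) gibbs_weight n (concat s w) * phi (concat s w)) /
  partition_function n w.

Lemma partition_function_gt0 n w : 0 < partition_function n w.
Proof.
rewrite /partition_function (bigD1 [ffun=> true]) //=.
by rewrite ltr_pwDl ?expR_gt0 // sumr_ge0 // => s _; exact: expR_ge0.
Qed.

Section replicas.
Variables (N k : nat) (w w' : config) (phi : config -> R) (C : R).
Hypothesis kN : (k <= N)%N.
Hypothesis phi_local : forall x y, agree (fun j => j < k)%N x y -> phi x = phi y.
Hypothesis phi_le : forall x, `|phi x| <= C.

Let state : finType := ({ffun 'I_N -> bool} * {ffun 'I_N -> bool})%type.
Let mix n (a b : {ffun 'I_N -> bool}) : {ffun 'I_N -> bool} :=
  [ffun i : 'I_N => if (i < n)%N then a i else b i].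
Let swap n (s : state) : state := (mix n s.2 s.1, mix n s.1 s.2).
Let x (s : state) := concat s.1 w.
Let x' (s : state) := concat s.2 w'.
(* Energies are shifted so that every pair contributes a factor at most 1. *)
Let V i (s : state) : R := expR (h i (x s) + h i (x' s) - 2 * T 0).
(* The weight of a reach less than [r]: the pairs beyond the reach are replaced by
   the least value of their factors.  A reach to [N] or beyond stands for the full
   interaction, boundary condition included. *)
Let W i r (s : state) : R := if r is r.+1 then
  if (i + r < N)%N then
    expR (pair_energy i r (x s) + pair_energy i r (x' s) - 2 * T 0 - 2 * T r)
  else V i s
  else 0.
Let cdf r : R := if r is r.+1 then if (r < N)%N then expR (- (4 * T r)) else 1 else 0.
Let d (s : state) : R := phi (x s) - phi (x' s).

Let swapK n : involutive (swap n).
Proof.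
move=> [a b]; rewrite /swap /mix /=.
by congr (_, _); apply/ffunP => i; rewrite !ffunE; case: (i < n)%N.
Qed.

Let x_swap_lt n s : (n <= N)%N -> agree (fun j => j < n)%N (x (swap n s)) (x' s).
Proof.
move=> nN j jn; have jN := leq_trans jn nN.
by rewrite /x /x' !concat_lt ffunE jn.
Qed.

Let x'_swap_lt n s : (n <= N)%N -> agree (fun j => j < n)%N (x' (swap n s)) (x s).
Proof.
move=> nN j jn; have jN := leq_trans jn nN.
by rewrite /x /x' !concat_lt ffunE jn.
Qed.

Let x_swap_ge n s : agree (fun j => n <= j)%N (x (swap n s)) (x s).
Proof.
move=> j nj; have [jN|Nj] := ltnP j N; last by rewrite /x !concat_ge.
by rewrite /x !concat_lt ffunE /= ltnNge nj.
Qed.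

Let x'_swap_ge n s : agree (fun j => n <= j)%N (x' (swap n s)) (x' s).
Proof.
move=> j nj; have [jN|Nj] := ltnP j N; last by rewrite /x' !concat_ge.
by rewrite /x' !concat_lt ffunE /= ltnNge nj.
Qed.

Let cdf_homo r : cdf r <= cdf r.+1.
Proof.
case: r => [|r] /=; first by case: ifP => _; rewrite ?expR_ge0 ?ler01.
have [rN|Nr] := ltnP r.+1 N.
  by rewrite (ltnW rN) ler_expR; have := T_rec r; have := K_ge0 r; lra.
by case: ifP => _ //; rewrite -[leRHS]expR0 ler_expR; have := T_ge0 r; lra.
Qed.

Let W_homo i r s : W i r s <= W i r.+1 s.
Proof.
case: r => [|r] /=; first by case: ifP => _; rewrite ?expR_ge0.
have [irN|Nir] := ltnP (i + r.+1) N.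
  rewrite (_ : (i + r < N)%N); last lia.
  rewrite ler_expR /pair_energy !big_ord_recr /=; have := T_rec r; have := K_ge0 r.
  have := K_spin_ge r (x s i) (x s (i + r.+1)%N).
  by have := K_spin_ge r (x' s i) (x' s (i + r.+1)%N); lra.
case: ifP => _ //; rewrite ler_expR.
have := h_tail i r (x s); have := h_tail i r (x' s).
by rewrite !ler_norml => /andP[? _] /andP[? _]; lra.
Qed.

Let W_cdf i r s : V i s * cdf r <= W i r s.
Proof.
case: r => [|r] /=; first by rewrite mulr0.
have [irN|Nir] := ltnP (i + r) N.
  rewrite (_ : (r < N)%N); last lia.
  rewrite -expRD ler_expR.
  have := h_tail i r (x s); have := h_tail i r (x' s).
  by rewrite !ler_norml => /andP[? ?] /andP[? ?]; lra.
rewrite ler_piMr ?expR_ge0 //; case: ifP => // _.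
by rewrite -[leRHS]expR0 ler_expR; have := T_ge0 r; lra.
Qed.

Let V_swap n i s : (n <= i < N)%N -> V i (swap n s) = V i s.
Proof.
move=> /andP[ni _]; rewrite /V.
rewrite (@h_past _ (x (swap n s)) (x s)); last first.
  by move=> j ij; apply: x_swap_ge; exact: leq_trans ij.
rewrite (@h_past _ (x' (swap n s)) (x' s)) //.
by move=> j ij; apply: x'_swap_ge; exact: leq_trans ij.
Qed.

Let W_swap n i r s : (i + r <= n <= N)%N -> W i r (swap n s) = W i r s.
Proof.
case: r => //= r irnN; rewrite (_ : (i + r < N)%N); last lia.
rewrite (@pair_energy_agree _ _ (x (swap n s)) (x' s)); last first.
  by move=> j ?; apply: x_swap_lt; lia.
rewrite (@pair_energy_agree _ _ (x' (swap n s)) (x s)); last first.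
  by move=> j ?; apply: x'_swap_lt; lia.
by rewrite [pair_energy i r (x' s) + _]addrC.
Qed.

Let d_swap n s : (k <= n <= N)%N -> d (swap n s) = - d s.
Proof.
move=> knN; rewrite /d opprB; congr (_ - _); apply: phi_local => j jk.
  by apply: x_swap_lt; lia.
by apply: x'_swap_lt; lia.
Qed.

Lemma gibbs_boundary :
  `|gibbs N phi w - gibbs N phi w'| *
    \sum_(n < (N - k).+1) \prod_(r < n) expR (- (4 * T r)) <= 2 * C * k.+1%:R.
Proof.
have cdf1 : cdf N.+1 = 1 by rewrite /cdf ltnn.
have WN i s : W i N.+1 s = V i s by rewrite /W ltnNge leq_addl.
have dC s : `|d s| <= 2 * C.
  have := ler_normB (phi (x s)) (phi (x' s)); have := phi_le (x s).
  by have := phi_le (x' s); rewrite /d; lra.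
have := replica_total (erefl : cdf 0 = 0) cdf1 cdf_homo swapK (fun i s => erefl : W i 0 s = 0)
  WN W_homo W_cdf V_swap W_swap d_swap dC kN.
(* The factor produced by the shift of the energies; it cancels in the ratio. *)
pose c : R := \prod_(i < N) expR (- (2 * T 0)).
have c0 : 0 < c by apply: prodr_gt0 => i _; exact: expR_gt0.
pose gw (s : {ffun 'I_N -> bool}) := gibbs_weight N (concat s w).
pose gw' (s : {ffun 'I_N -> bool}) := gibbs_weight N (concat s w').
have VE s : \prod_(i < N) V i s = c * (gw s.1 * gw' s.2).
  rewrite /V /gw /gw' /gibbs_weight !expR_sum -big_split /= /c.
  by rewrite -big_split; apply: eq_bigr => i _ /=; rewrite -!expRD; congr expR; rewrite addrC.
have sumE (F G : {ffun 'I_N -> bool} -> R) :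
    \sum_(s : state) F s.1 * G s.2 = (\sum_a F a) * (\sum_b G b).
  by rewrite big_distrlr /= pair_bigA.
rewrite [X in _ <= _ * X -> _](eq_bigr (fun s : state => c * (gw s.1 * gw' s.2)));
  last by move=> s _; exact: VE.
rewrite -mulr_sumr sumE -/(partition_function N w) -/(partition_function N w').
have -> : \sum_s d s * \prod_(i < N) V i s =
   c * ((\sum_a gw a * phi (concat a w)) * partition_function N w' -
        partition_function N w * (\sum_a gw' a * phi (concat a w'))).
  rewrite -!sumE -sumrB mulr_sumr; apply: eq_bigr => s _; rewrite VE /d /x /x'.
  by rewrite -/(gw s.1) -/(gw' s.2); move: (gw _) (gw' _) (phi _) (phi _) => *; ring.
set A := \sum_a _; set A' := \sum_a _.
have Z0 := partition_function_gt0 N w; have Z'0 := partition_function_gt0 N w'.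
have -> : A * partition_function N w' - partition_function N w * A' =
    (gibbs N phi w - gibbs N phi w') * (partition_function N w * partition_function N w').
  by rewrite /gibbs -/A -/A'; field; rewrite !gt_eqF.
rewrite !normrM (gtr0_norm c0) (gtr0_norm Z0) (gtr0_norm Z'0) => H.
set U := \sum_(n < _) _.
have UE : \sum_(n < (N - k).+1) renewal_mass cdf n = U.
  apply: eq_bigr => -[n nN] _ /=; apply: eq_bigr => -[r rn] _ /=.
  by rewrite (_ : (r < N)%N) //; lia.
have P0 : 0 < c * (partition_function N w * partition_function N w') by rewrite !mulr_gt0.
rewrite -(ler_pM2r P0); apply: le_trans H; rewrite UE le_eqVlt; apply/orP; left.
by apply/eqP; ring.
Qed.
End replicas.

End gibbs.

(** * Quasilocal functions *)

Section quasilocal.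
Variable R : realType.

Definition depends_on (P : nat -> bool) (phi : config -> R) : Prop :=
  forall w w', agree P w w' -> phi w = phi w'.

(** Uniform continuity for the product topology; by compactness this is the same
    as continuity. *)
Definition quasilocal (phi : config -> R) : Prop :=
  forall e, 0 < e -> exists m, forall w w',
    agree (fun k => k < m)%N w w' -> `|phi w - phi w'| <= e.

Definition truncate (m : nat) (w : config) : config :=
  fun k => if (k < m)%N then w k else false.

Lemma agree_truncate m w : agree (fun k => k < m)%N w (truncate m w).
Proof. by move=> k km; rewrite /truncate km. Qed.

Lemma agree_le m m' w w' : (m <= m')%N ->
  agree (fun k => k < m')%N w w' -> agree (fun k => k < m)%N w w'.
Proof. by move=> mm' ww' k km; apply: ww'; exact: leq_trans mm'. Qed.

Lemma agree_concat m n (s : {ffun 'I_n -> bool}) w w' :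
  agree (fun k => k < m)%N w w' -> agree (fun k => k < m)%N (concat s w) (concat s w').
Proof. by move=> ww' k km; rewrite /concat; case: insubP => // _; exact: ww'. Qed.

Lemma agree_set_site m n b w w' :
  agree (fun k => k < m)%N w w' -> agree (fun k => k < m)%N (set_site n b w) (set_site n b w').
Proof. by move=> ww' k km; rewrite /set_site; case: eqP => // _; exact: ww'. Qed.

Lemma concat_eq n (s : {ffun 'I_n -> bool}) w w' :
  agree (fun k => n <= k)%N w w' -> concat s w = concat s w'.
Proof.
move=> ww'; apply/funext => k; have [kn|nk] := ltnP k n; first by rewrite !concat_lt.
by rewrite !concat_ge // ww'.
Qed.

Lemma config_fin m (phi : config -> R) : depends_on (fun k => k < m)%N phi ->
  exists C, forall w, `|phi w| <= C.
Proof.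
move=> phi_m.
exists (\sum_(s : {ffun 'I_m -> bool}) `|phi (concat s (fun=> false))|) => w.
rewrite (phi_m w (concat [ffun i : 'I_m => w i] (fun=> false))); last first.
  by move=> k km; rewrite concat_lt ffunE.
by rewrite (bigD1 [ffun i : 'I_m => w i]) //= lerDl sumr_ge0.
Qed.

Lemma local_quasilocal m (phi : config -> R) :
  depends_on (fun k => k < m)%N phi -> quasilocal phi.
Proof.
by move=> phi_m e e0; exists m => w w' ww'; rewrite (phi_m _ _ ww') subrr normr0 ltW.
Qed.

Lemma depends_truncate m (phi : config -> R) :
  depends_on (fun k => k < m)%N (phi \o truncate m).
Proof.
move=> w w' ww' /=; congr phi; apply/funext => k; rewrite /truncate.
by case: ifP => // /ww'.
Qed.

Lemma quasilocal_approx phi e : quasilocal phi -> 0 < e ->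
  exists m, forall w, `|phi w - phi (truncate m w)| <= e.
Proof. by move=> ql /ql[m H]; exists m => w; apply: H; exact: agree_truncate. Qed.

Lemma quasilocal_bounded phi : quasilocal phi -> exists C, forall w, `|phi w| <= C.
Proof.
move=> /quasilocal_approx/(_ ltr01)[m H].
have [C HC] := config_fin (@depends_truncate m phi).
exists (C + 1) => w; rewrite -[phi w](subrK (phi (truncate m w))) addrC.
by apply: le_trans (ler_normD _ _) _; rewrite lerD //; exact: HC.
Qed.

Lemma quasilocal_cst c : quasilocal (fun=> c).
Proof. by apply: (@local_quasilocal 0). Qed.

Lemma quasilocalD phi psi : quasilocal phi -> quasilocal psi ->
  quasilocal (fun w => phi w + psi w).
Proof.
move=> H1 H2 e e0; have e20 : 0 < e / 2 by rewrite divr_gt0.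
have [m1 {}H1] := H1 _ e20; have [m2 {}H2] := H2 _ e20.
exists (maxn m1 m2) => w w' ww'.
have /H1 := agree_le (leq_maxl _ _) ww'; have /H2 := agree_le (leq_maxr _ _) ww'.
by rewrite !ler_norml => /andP[? ?] /andP[? ?]; apply/andP; lra.
Qed.

Lemma quasilocalM phi psi : quasilocal phi -> quasilocal psi ->
  quasilocal (fun w => phi w * psi w).
Proof.
move=> H1 H2 e e0.
have [A HA] := quasilocal_bounded H1; have [B HB] := quasilocal_bounded H2.
have A0 : 0 <= A by exact: le_trans (normr_ge0 _) (HA (fun=> true)).
have B0 : 0 <= B by exact: le_trans (normr_ge0 _) (HB (fun=> true)).
have e'0 : 0 < e / (A + B + 1) by rewrite divr_gt0 //; lra.
have e'E : e / (A + B + 1) * (A + B + 1) = e by rewrite divfK //; lra.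
move: (e / _) e'0 e'E => e' e'0 e'E.
have [m1 {}H1] := H1 _ e'0; have [m2 {}H2] := H2 _ e'0.
exists (maxn m1 m2) => w w' ww'.
have /H1 h1 := agree_le (leq_maxl _ _) ww'; have /H2 h2 := agree_le (leq_maxr _ _) ww'.
rewrite (_ : _ - _ = phi w * (psi w - psi w') + (phi w - phi w') * psi w'); last by ring.
apply: le_trans (ler_normD _ _) _; rewrite !normrM.
apply: le_trans (_ : A * e' + e' * B <= e); last by lra.
by rewrite lerD // ler_pM.
Qed.

Lemma quasilocalZ c phi : quasilocal phi -> quasilocal (fun w => c * phi w).
Proof. by move=> ?; apply: quasilocalM => //; exact: quasilocal_cst. Qed.

Lemma quasilocal_sum (I : Type) (r : seq I) (phi : I -> config -> R) :
  (forall i, quasilocal (phi i)) -> quasilocal (fun w => \sum_(i <- r) phi i w).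
Proof.
move=> H; elim: r => [|i r IH].
  by under eq_fun do rewrite big_nil; exact: quasilocal_cst.
by under eq_fun do rewrite big_cons; exact: quasilocalD.
Qed.

Lemma quasilocal_exp phi : quasilocal phi -> quasilocal (fun w => expR (phi w)).
Proof.
move=> H e e0; have [C HC] := quasilocal_bounded H.
have [m {}H] := H (e * expR (- C)) (mulr_gt0 e0 (expR_gt0 _)).
exists m => w w' /H {}H.
have lip a b : `|a| <= C -> `|b| <= C -> `|a - b| <= e * expR (- C) ->
    expR b - expR a <= e.
  move=> aC bC ab.
  have -> : expR b - expR a = expR b * (1 - expR (a - b)).
    by rewrite mulrBr mulr1 -expRD [b + _]addrC subrK.
  apply: le_trans (_ : expR C * (e * expR (- C)) <= e).
    have [ba|ba] := leP (1 - expR (a - b)) 0.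
      apply: le_trans (_ : 0 <= _); first by rewrite mulr_ge0_le0 ?expR_ge0.
      by rewrite !mulr_ge0 ?expR_ge0 ?ltW.
    apply: ler_pM; rewrite ?expR_ge0 ?(ltW ba) //.
      by rewrite ler_expR; exact: le_trans (ler_norm _) bC.
    have := expR_ge1Dx (a - b); move: ab; rewrite ler_norml => /andP[? _]; lra.
  by rewrite mulrCA expRN divff ?mulr1 // gt_eqF ?expR_gt0.
rewrite ler_norml; apply/andP; split; last first.
  by apply: lip => //; rewrite distrC.
by have := lip _ _ (HC w) (HC w') H; lra.
Qed.

Lemma quasilocal_inv phi c : 0 < c -> (forall w, c <= phi w) -> quasilocal phi ->
  quasilocal (fun w => (phi w)^-1).
Proof.
move=> c0 Hc H e e0; have [m {}H] := H (e * (c * c)) (mulr_gt0 e0 (mulr_gt0 c0 c0)).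
exists m => w w' /H {}H.
have p0 x : 0 < phi x by exact: lt_le_trans (Hc x).
have -> : (phi w)^-1 - (phi w')^-1 = (phi w' - phi w) / (phi w * phi w').
  by field; rewrite !gt_eqF.
rewrite normrM normfV [X in _ / X]gtr0_norm ?mulr_gt0 // ler_pdivrMr ?mulr_gt0 //.
rewrite distrC; apply: le_trans H _; apply: ler_wpM2l; first exact: ltW.
by apply: ler_pM => //; exact: ltW.
Qed.

Lemma quasilocal_comp (f : config -> config) phi :
  (forall m w w', agree (fun k => k < m)%N w w' -> agree (fun k => k < m)%N (f w) (f w')) ->
  quasilocal phi -> quasilocal (phi \o f).
Proof. by move=> Hf H e /H[m {}H]; exists m => w w' /Hf/H. Qed.

End quasilocal.

(** * Consistency of the kernels and convergence of Gibbs expectations *)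

Section kernels.
Variables (R : realType) (K T : nat -> R) (h : nat -> config -> R).
Hypothesis K_ge0 : forall r, 0 <= K r.+1.
Hypothesis T_rec : forall r, T r = K r.+1 + T r.+1.
Hypothesis T_cvg : T @ \oo --> (0 : R).
Hypothesis h_tail : forall i r w, `|h i w - pair_energy K i r w| <= T r.

(** The conditional probability of the spin at [n] given the sites beyond [n],
    under the Gibbs distribution of the sites up to [n]. *)
Definition conditional (n : nat) (w : config) : R :=
  (\sum_(s : {ffun 'I_n -> bool}) gibbs_weight h n.+1 (concat s w)) /
  partition_function h n.+1 w.

Definition resample (n : nat) (phi : config -> R) (w : config) : R :=
  \sum_(b : bool) conditional n (set_site n b w) * phi (set_site n b w).

(** A configuration on [n.+1] sites is one on [n] sites and a spin at [n]. *)
Lemma sum_concatS n (F : config -> R) w :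
  \sum_(s : {ffun 'I_n.+1 -> bool}) F (concat s w) =
  \sum_(b : bool) \sum_(s : {ffun 'I_n -> bool}) F (concat s (set_site n b w)).
Proof.
rewrite pair_bigA /=.
pose ext (p : bool * {ffun 'I_n -> bool}) : {ffun 'I_n.+1 -> bool} :=
  [ffun i : 'I_n.+1 => concat p.2 (fun=> p.1) i].
pose res (s : {ffun 'I_n.+1 -> bool}) : bool * {ffun 'I_n -> bool} :=
  (s ord_max, [ffun j => s (widen_ord (leqnSn n) j)]).
rewrite (reindex ext); last first.
  exists res => [[b s] _|s _].
    rewrite /res /ext /= ffunE concat_ge //; congr (_, _); apply/ffunP => j.
    by rewrite !ffunE /= (concat_lt _ _ (ltn_ord j)); congr (s _); apply: val_inj.
  apply/ffunP => i; rewrite ffunE /=; have [lin|nli] := ltnP i n.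
    by rewrite concat_lt ffunE; congr (s _); apply: val_inj.
  rewrite concat_ge //; congr (s _); apply: val_inj => /=.
  by have := ltn_ord i; lia.
apply: eq_bigr => -[b s] _ /=; congr F; apply/funext => k.
have [kn|nk] := ltnP k n.
  by rewrite (concat_lt _ _ (ltnW kn : k < n.+1)%N) ffunE /= !concat_lt.
rewrite [RHS]concat_ge // /set_site; case: eqP => [->|/eqP kn].
  by rewrite (concat_lt _ _ (ltnSn n)) ffunE /= concat_ge.
by rewrite concat_ge // ltn_neqAle eq_sym kn.
Qed.

Lemma gibbs_weightS n w :
  gibbs_weight h n.+1 w = gibbs_weight h n w * expR (h n w).
Proof. by rewrite /gibbs_weight big_ord_recr /= expRD. Qed.

Lemma partition_function_past n w w' : agree (fun k => n <= k)%N w w' ->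
  partition_function h n w = partition_function h n w'.
Proof. by move=> ww'; apply: eq_bigr => s _; rewrite (concat_eq s ww'). Qed.

Lemma gibbs_past n phi : depends_on (fun k => n <= k)%N (gibbs h n phi).
Proof.
move=> w w' ww'; rewrite /gibbs (partition_function_past ww'); congr (_ / _).
by apply: eq_bigr => s _; rewrite (concat_eq s ww').
Qed.

Lemma agree_set_past n b w : agree (fun k => n.+1 <= k)%N (set_site n b w) w.
Proof. by move=> k nk; rewrite /set_site gtn_eqF. Qed.

Lemma agree_concat_past n (s : {ffun 'I_n -> bool}) w :
  agree (fun k => n <= k)%N (concat s w) w.
Proof. by move=> k nk; rewrite concat_ge. Qed.

Let pf_gt0 := @partition_function_gt0 R h.

Lemma conditionalE n w :
  conditional n w = expR (h n w) * partition_function h n w / partition_function h n.+1 w.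
Proof.
rewrite /conditional /partition_function mulr_sumr; congr (_ / _).
apply: eq_bigr => s _; rewrite gibbs_weightS mulrC; congr (expR _ * _).
apply: (h_past T_cvg h_tail); exact: agree_concat_past.
Qed.

(** The weight of the first [n.+1] sites is that of the first [n] times a function
    of the sites from [n] on, which cancels against the normalisation. *)
Lemma resample_gibbs n phi w : resample n (gibbs h n phi) w = gibbs h n.+1 phi w.
Proof.
rewrite /resample /gibbs (sum_concatS _ (fun x => gibbs_weight h n.+1 x * phi x)).
rewrite mulr_suml; apply: eq_bigr => b _.
rewrite conditionalE (partition_function_past (@agree_set_past n b w)).
have cancel (a z z' x : R) : 0 < z -> 0 < z' -> a * z / z' * (x / z) = a * x / z'.
  by move=> z0 z'0; field; rewrite !gt_eqF.
rewrite cancel ?pf_gt0 //.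
congr (_ / _); rewrite mulr_sumr; apply: eq_bigr => s _.
rewrite gibbs_weightS (@h_past _ _ _ _ T_cvg h_tail n (concat _ _) (set_site n b w)).
  by rewrite mulrA; congr (_ * _); rewrite mulrC.
exact: agree_concat_past.
Qed.

Lemma gibbs_id n phi w : depends_on (fun k => n <= k)%N phi -> gibbs h n phi w = phi w.
Proof.
move=> phi_n; rewrite /gibbs.
under eq_bigr => s _ do rewrite (phi_n _ _ (@agree_concat_past n s w)).
by rewrite -mulr_suml -/(partition_function h n w) mulrAC divff ?mul1r // gt_eqF.
Qed.

Lemma gibbs0 phi : gibbs h 0 phi = phi.
Proof.
apply/funext => w; apply: gibbs_id => w1 w2 w12; congr phi.
by apply/funext => k; exact: w12.
Qed.

Lemma resample_past n phi : depends_on (fun k => n <= k)%N phi ->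
  depends_on (fun k => n.+1 <= k)%N (resample n phi).
Proof.
move=> phi_n w w' ww'; have E : resample n phi = resample n (gibbs h n phi).
  by congr resample; apply/funext => x; rewrite gibbs_id.
by rewrite E !resample_gibbs; exact: gibbs_past.
Qed.

Lemma conditional_ge0 n w : 0 <= conditional n w.
Proof.
by rewrite divr_ge0 ?(ltW (pf_gt0 _ _)) // sumr_ge0 // => s _; exact: expR_ge0.
Qed.

Lemma conditional_sum n w : \sum_(b : bool) conditional n (set_site n b w) = 1.
Proof.
have := resample_gibbs n (fun=> 1) w; rewrite gibbs_id // => <-.
by apply: eq_bigr => b _; rewrite gibbs_id // mulr1.
Qed.

Lemma gibbsD n a phi psi w :
  gibbs h n (fun x => a * phi x + psi x) w = a * gibbs h n phi w + gibbs h n psi w.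
Proof.
rewrite /gibbs mulrA -mulrDl mulr_sumr -big_split /=; congr (_ / _).
by apply: eq_bigr => s _; ring.
Qed.

Lemma le_gibbs n phi psi w : (forall x, phi x <= psi x) -> gibbs h n phi w <= gibbs h n psi w.
Proof.
move=> H; rewrite ler_wpM2r ?invr_ge0 ?(ltW (pf_gt0 _ _)) //.
by apply: ler_sum => s _; rewrite ler_wpM2l // expR_ge0.
Qed.

Lemma gibbs_cst n c w : gibbs h n (fun=> c) w = c.
Proof. by rewrite gibbs_id. Qed.

(** Larger volumes average over the boundary conditions of smaller ones, so that
    the range of the expectations shrinks. *)
Lemma gibbs_mono n m phi a : (n <= m)%N ->
  (forall w, a <= gibbs h n phi w) -> forall w, a <= gibbs h m phi w.
Proof.
move=> /subnK <- H; elim: (m - n)%N => // j IH w; rewrite addSn -resample_gibbs.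
rewrite -[leLHS]mul1r -(conditional_sum (j + n) w) mulr_suml.
by apply: ler_sum => b _; rewrite ler_wpM2l // conditional_ge0.
Qed.

Lemma gibbs_mono_ub n m phi a : (n <= m)%N ->
  (forall w, gibbs h n phi w <= a) -> forall w, gibbs h m phi w <= a.
Proof.
move=> /subnK <- H; elim: (m - n)%N => // j IH w; rewrite addSn -resample_gibbs.
rewrite -[leRHS]mul1r -(conditional_sum (j + n) w) mulr_suml.
by apply: ler_sum => b _; rewrite ler_wpM2l // conditional_ge0.
Qed.

(** At volume [n.+1] both sides are [resample n phi]; larger volumes are obtained by
    applying the same kernels to both. *)
Lemma gibbs_resample n m phi w : (n < m)%N -> depends_on (fun k => n <= k)%N phi ->
  gibbs h m (resample n phi) w = gibbs h m phi w.
Proof.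
move=> /subnK <- phi_n; elim: (m - n.+1)%N w => [|j IH] w; last first.
  by rewrite !addSn -!resample_gibbs; congr resample; apply/funext.
rewrite add0n gibbs_id; last exact: resample_past.
rewrite -resample_gibbs; congr resample; apply/funext => x.
by rewrite gibbs_id.
Qed.

Lemma quasilocal_h i : quasilocal (h i).
Proof.
move=> e e0; have /cvgrPdist_lt/(_ (e / 2)) [] := T_cvg; first by rewrite divr_gt0.
move=> r _ /(_ r (leqnn r)) /=; rewrite sub0r normrN ger0_norm ?(T_ge0 h_tail) // => Tr.
exists (i + r).+1 => w w' ww'; apply: le_trans (h_agree h_tail (r := r) _) _; last lra.
by move=> k /andP[_ ?]; exact: ww'.
Qed.

Lemma quasilocal_gibbs_weight n : quasilocal (gibbs_weight h n).
Proof. by apply: quasilocal_exp; apply: quasilocal_sum => i; exact: quasilocal_h. Qed.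

Lemma quasilocal_partition n : quasilocal (partition_function h n).
Proof.
apply: quasilocal_sum => s; apply: (quasilocal_comp _ (@quasilocal_gibbs_weight n)).
by move=> m w w'; exact: agree_concat.
Qed.

(** The energies are bounded, whence a positive lower bound for the partition
    function. *)
Lemma quasilocal_inv_partition n : quasilocal (fun w => (partition_function h n w)^-1).
Proof.
apply: (@quasilocal_inv _ _ (expR (- (n%:R * T 0)))) (@quasilocal_partition n).
  exact: expR_gt0.
move=> w; rewrite /partition_function (bigD1 [ffun=> true]) //=.
rewrite -[leLHS]addr0 lerD ?sumr_ge0 // => [|s _]; last exact: expR_ge0.
rewrite ler_expR (_ : - _ = \sum_(i < n) - T 0).
  apply: ler_sum => i _; have := h_tail i 0%N (concat ([ffun=> true] : {ffun 'I_n -> bool}) w).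
  by rewrite /pair_energy big_ord0 subr0 ler_norml => /andP[].
by rewrite sumr_const card_ord mulNrn mulr_natl.
Qed.

Lemma quasilocal_conditional n : quasilocal (conditional n).
Proof.
apply: quasilocalM; last exact: quasilocal_inv_partition.
apply: quasilocal_sum => s; apply: (quasilocal_comp _ (@quasilocal_gibbs_weight n.+1)).
by move=> m w w'; exact: agree_concat.
Qed.

Lemma quasilocal_resample n phi : quasilocal phi -> quasilocal (resample n phi).
Proof.
move=> H; apply: quasilocal_sum => b.
apply: (quasilocal_comp (f := set_site n b)
  (phi := fun w => conditional n w * phi w)).
  by move=> m w w'; exact: agree_set_site.
by apply: quasilocalM => //; exact: quasilocal_conditional.
Qed.

Lemma quasilocal_gibbs n phi : quasilocal phi -> quasilocal (gibbs h n phi).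
Proof.
elim: n phi => [|n IH] phi H; first by rewrite gibbs0.
rewrite (_ : gibbs h n.+1 phi = resample n (gibbs h n phi)).
  by apply: quasilocal_resample; exact: IH.
by apply/funext => w; rewrite resample_gibbs.
Qed.

Hypothesis renewal_divergence : forall A : R, exists n,
  A <= \sum_(i < n) \prod_(r < i) expR (- (4 * T r)).

(** For a function of the first [k] spins this is [gibbs_boundary]; a quasilocal
    function is within [e / 3] of such a function. *)
Lemma gibbs_osc phi e : quasilocal phi -> 0 < e ->
  exists n, forall w w', `|gibbs h n phi w - gibbs h n phi w'| <= e.
Proof.
move=> H e0; have e30 : 0 < e / 3 by rewrite divr_gt0.
have [k Hk] := quasilocal_approx H e30.
have [C HC] := config_fin (@depends_truncate R k phi).
have C0 : 0 <= C by exact: le_trans (normr_ge0 _) (HC (fun=> true)).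
have [n0 Hn0] := renewal_divergence (2 * C * k.+1%:R / (e / 3) + 1).
exists (k + n0)%N => w w'.
have kn : (k <= k + n0)%N by exact: leq_addr.
have := gibbs_boundary K_ge0 T_rec T_cvg h_tail w w' kn (@depends_truncate R k phi) HC.
rewrite addKn; set U := \sum_(_ < _) _.
have U0 : 2 * C * k.+1%:R / (e / 3) + 1 <= U.
  apply: le_trans Hn0 _; rewrite /U big_ord_recr /= lerDl.
  by apply: prodr_ge0 => *; exact: expR_ge0.
set psi := phi \o truncate k => Hpsi.
have close x : `|gibbs h (k + n0) phi x - gibbs h (k + n0) psi x| <= e / 3.
  have -> : gibbs h (k + n0) phi x - gibbs h (k + n0) psi x =
      gibbs h (k + n0) (fun y => -1 * psi y + phi y) x by rewrite gibbsD; ring.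
  rewrite ler_norml -{1}(gibbs_cst (k + n0) (- (e / 3)) x).
  rewrite -[X in _ && (_ <= X)](gibbs_cst (k + n0) (e / 3) x).
  by apply/andP; split; apply: le_gibbs => y; have := Hk y;
    rewrite ler_norml /psi /= => /andP[? ?]; lra.
have Upos : 0 < U.
  apply: lt_le_trans U0; apply: ltr_wpDl => //; apply: divr_ge0; last exact: ltW.
  by rewrite !mulr_ge0.
have D : `|gibbs h (k + n0) psi w - gibbs h (k + n0) psi w'| <= e / 3.
  rewrite -(ler_pM2r Upos); apply: le_trans Hpsi _.
  rewrite -ler_pdivrMl // mulrC; apply: le_trans U0; lra.
have := close w; have := close w'; move: D; rewrite !ler_norml.
by move=> /andP[? ?] /andP[? ?] /andP[? ?]; apply/andP; lra.
Qed.

(** The expectations at volume [n] take values in an interval that shrinks to a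
    point as [n] grows; the supremum of the lower bounds is that point. *)
Definition limit_state (phi : config -> R) : R :=
  sup [set a | exists n, forall w, a <= gibbs h n phi w].

Lemma gibbs_cvg phi e : quasilocal phi -> 0 < e ->
  exists n0, forall n w, (n0 <= n)%N -> `|gibbs h n phi w - limit_state phi| <= e.
Proof.
move=> H e0; have [n0 Hn0] := gibbs_osc H e0; exists n0 => n w n0n.
pose A := [set a | exists n, forall w, a <= gibbs h n phi w].
have lb a m b m' : (forall w, a <= gibbs h m phi w) ->
    (forall w, gibbs h m' phi w <= b) -> a <= b.
  move=> Ha Hb.
  have := gibbs_mono (leq_maxl m m') Ha (fun=> true).
  by have := gibbs_mono_ub (leq_maxr m m') Hb (fun=> true); lra.
pose w0 : config := fun=> true.
have Al w1 : A (gibbs h n0 phi w1 - e).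
  by exists n0 => w'; have := Hn0 w1 w'; rewrite ler_norml => /andP[_ ?]; lra.
have Au w1 : ubound A (gibbs h n0 phi w1 + e).
  move=> a [m Ha]; apply: lb Ha _ => w'.
  by have := Hn0 w1 w'; rewrite ler_norml => /andP[? ?]; lra.
have Lub w1 : limit_state phi <= gibbs h n0 phi w1 + e.
  by apply: ge_sup; [exists (gibbs h n0 phi w1 - e); exact: Al | exact: Au].
have Llb w1 : gibbs h n0 phi w1 - e <= limit_state phi.
  by apply: ub_le_sup; [exists (gibbs h n0 phi w1 + e); exact: Au | exact: Al].
rewrite ler_norml; apply/andP; split.
  rewrite lerBrDl; apply: (gibbs_mono n0n) => w1.
  by have := Lub w1; lra.
rewrite lerBlDl; apply: (gibbs_mono_ub n0n) => w1.
by have := Llb w1; lra.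
Qed.

Lemma limit_state_unique phi l : quasilocal phi ->
  (forall e, 0 < e -> exists n0, forall n w, (n0 <= n)%N -> `|gibbs h n phi w - l| <= e) ->
  l = limit_state phi.
Proof.
move=> H Hl; apply/eqP; rewrite -subr_eq0 -normr_le0; apply/ler_addgt0Pr => e e0.
have e20 : 0 < e / 2 by rewrite divr_gt0.
have [n1 H1] := Hl _ e20; have [n2 H2] := gibbs_cvg H e20.
have := H1 _ (fun=> true) (leq_maxl n1 n2); have := H2 _ (fun=> true) (leq_maxr n1 n2).
by rewrite add0r !ler_norml => /andP[? ?] /andP[? ?]; apply/andP; lra.
Qed.

Lemma limit_stateD a phi psi : quasilocal phi -> quasilocal psi ->
  limit_state (fun w => a * phi w + psi w) = a * limit_state phi + limit_state psi.
Proof.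
move=> H1 H2; apply/esym/limit_state_unique.
  by apply: quasilocalD => //; exact: quasilocalZ.
move=> e e0; have e'0 : 0 < e / (`|a| + 1) by rewrite divr_gt0 // ltr_wpDl.
have [n1 {}H1] := gibbs_cvg H1 e'0; have [n2 {}H2] := gibbs_cvg H2 e'0.
exists (maxn n1 n2) => n w; rewrite geq_max => /andP[/(H1 n w) h1 /(H2 n w) h2].
rewrite gibbsD (_ : _ - _ = a * (gibbs h n phi w - limit_state phi) +
  (gibbs h n psi w - limit_state psi)); last by ring.
apply: le_trans (ler_normD _ _) _; rewrite normrM.
apply: le_trans (_ : `|a| * (e / (`|a| + 1)) + e / (`|a| + 1) <= e).
  by rewrite lerD // ler_wpM2l.
by rewrite -[X in _ + X]mul1r -mulrDl mulrC divfK // gt_eqF // ltr_wpDl.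
Qed.

Lemma limit_state_cst c : limit_state (fun=> c) = c.
Proof.
apply/esym/limit_state_unique; first exact: quasilocal_cst.
by move=> e e0; exists 0%N => n w _; rewrite gibbs_cst subrr normr0 ltW.
Qed.

Lemma limit_state_ge0 phi : quasilocal phi -> (forall w, 0 <= phi w) -> 0 <= limit_state phi.
Proof.
move=> H H0; apply/ler_addgt0Pr => e e0; have [n Hn] := gibbs_cvg H e0.
have := Hn n (fun=> true) (leqnn _); rewrite ler_norml => /andP[_].
have : 0 <= gibbs h n phi (fun=> true); last by lra.
by rewrite -(gibbs_cst n 0 (fun=> true)); exact: le_gibbs.
Qed.

Lemma limit_state_resample n phi : quasilocal phi -> depends_on (fun k => n <= k)%N phi ->
  limit_state (resample n phi) = limit_state phi.
Proof.
move=> H phi_n; apply: limit_state_unique => // e e0.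
have [n0 Hn0] := gibbs_cvg (@quasilocal_resample n _ H) e0.
exists (maxn n0 n.+1) => m w; rewrite geq_max => /andP[n0m nm].
by rewrite -(gibbs_resample w nm phi_n); exact: Hn0.
Qed.

End kernels.

(** * Events depending on finitely many spins *)

(** The spins at the sites below [m], those below [n] being masked. *)
Definition window (n m : nat) (w : config) : {ffun 'I_m -> bool} :=
  [ffun i : 'I_m => (n <= i)%N && w i].

Lemma window_eq n m w w' :
  window n m w = window n m w' <-> agree (fun k => n <= k < m)%N w w'.
Proof.
split=> [/ffunP ww' k /andP[nk km]|ww'].
  by have := ww' (Ordinal km); rewrite !ffunE /= nk.
apply/ffunP => i; rewrite !ffunE; case: leqP => //= ni.
by rewrite ww' // ni ltn_ord.
Qed.

Definition window_event (n : nat) (A : set config) : Prop :=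
  exists m, forall w w', window n m w = window n m w' -> A w -> A w'.

Lemma window_event_past n A : window_event n A -> window_event 0 A.
Proof.
move=> [m H]; exists m => w w' /window_eq ww'; apply: H; apply/window_eq.
by move=> k /andP[_ km]; exact: ww'.
Qed.

Lemma window_eventI n : setI_closed (window_event n).
Proof.
move=> A B [a HA] [b HB]; exists (maxn a b) => w w' /window_eq ww' [Aw Bw].
split; [apply: HA Aw | apply: HB Bw]; apply/window_eq => k kab; apply: ww'; lia.
Qed.

Lemma F_le_window n m t : F_le n [set w | window n m w = t].
Proof.
pose T := g_sigma_algebraType (coord_events n).
suff : measurable ([set w | window n m w = t] : set T) by [].
rewrite (_ : mkset _ = \bigcap_(i in [set: 'I_m]) [set w : T | (n <= i)%N && w i = t i]); last first.
  apply/seteqP; split => w /= => [<- i _ /=|H]; first by rewrite ffunE.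
  by apply/ffunP => i; rewrite ffunE; exact: H.
apply: fin_bigcap_measurable; first exact: finite_finset.
move=> i _; have [ni|_] := leqP n i; last first.
  case: (t i) => /=; last by rewrite (_ : mkset _ = setT) // -subTset.
  by rewrite (_ : mkset _ = set0) // -subset0.
apply: sub_sigma_algebra; exists (i : nat) => //=; exists [set t i] => //.
by rewrite setTI.
Qed.

Lemma window_event_F_le n A : window_event n A -> F_le n A.
Proof.
move=> [m H]; pose T := g_sigma_algebraType (coord_events n).
suff : measurable (A : set T) by [].
rewrite (_ : A = \bigcup_(t in window n m @` A) [set w : T | window n m w = t]).
  apply: fin_bigcup_measurable; first exact: finite_finset.
  by move=> t _; exact: F_le_window.
apply/seteqP; split => [w Aw|w [_ [w' Aw' <-]] /= ww']; first by exists (window n m w).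
exact: H Aw'.
Qed.

Lemma F_le_measurable n A : F_le n A -> measurable (A : set config).
Proof.
apply: sub_smallest2r; first exact: smallest_sigma_algebra.
by move=> B [k _ HB]; exists k.
Qed.

(** The window events form a pi-system that generates [F_le n]. *)
Lemma F_le_ind n (D : set (set config)) : dynkin D -> window_event n `<=` D ->
  F_le n `<=` D.
Proof.
move=> dD wD; apply: subset_trans (_ : <<s window_event n >> `<=` D).
  apply: sub_smallest2r; first exact: smallest_sigma_algebra.
  move=> _ [k nk [C _ <-]]; exists k.+1 => w w' /window_eq ww' [_ Cw]; split => //=.
  by rewrite /preimage /= -ww' //; apply/andP; split.
by rewrite -(setI_closed_g_dynkin_g_sigma_algebra (@window_eventI n)); exact: smallest_sub.
Qed.

(** * Positive normalised functionals on quasilocal functions *)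

Section means.
Variable R : realType.
Local Notation quasilocal := (@quasilocal R).
Local Notation depends_on := (@depends_on R).

Definition mean (I : (config -> R) -> R) : Prop :=
  [/\ forall a phi psi, quasilocal phi -> quasilocal psi ->
        I (fun w => a * phi w + psi w) = a * I phi + I psi,
      forall phi, quasilocal phi -> (forall w, 0 <= phi w) -> 0 <= I phi &
      I (fun=> 1) = 1].

Lemma quasilocal_event n A : window_event n A -> quasilocal (\1_A : config -> R).
Proof.
move=> /window_event_past[m H]; apply: (@local_quasilocal _ m) => w w' ww'.
rewrite !indicE; congr (nat_of_bool _)%:R.
by apply/idP/idP; rewrite !inE; apply: H; apply/window_eq => k km; rewrite ww'.
Qed.

Lemma depends_event n A : window_event n A ->
  depends_on (fun k => n <= k)%N (\1_A : config -> R).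
Proof.
move=> [m H] w w' ww'; rewrite !indicE; congr (nat_of_bool _)%:R.
by apply/idP/idP; rewrite !inE; apply: H; apply/window_eq => k /andP[? _]; rewrite ww'.
Qed.

Lemma window_event_set n m t : window_event n [set w | window n m w = t].
Proof. by exists m => w w' /= ->. Qed.

Lemma quasilocal_window n m t : quasilocal (\1_[set w | window n m w = t] : config -> R).
Proof. by apply: quasilocal_event; exact: window_event_set. Qed.

Lemma mean_sum I (J : Type) (r : seq J) (c : J -> R) (phi : J -> config -> R) :
  mean I -> (forall j, quasilocal (phi j)) ->
  I (fun w => \sum_(j <- r) c j * phi j w) = \sum_(j <- r) c j * I (phi j).
Proof.
move=> [Ilin _ _] H; have I0 : I (fun=> 0) = 0.
  have := Ilin 1 (fun=> 0) (fun=> 0) (quasilocal_cst 0) (quasilocal_cst 0).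
  rewrite (_ : (fun=> 1 * 0 + 0) = (fun=> 0 : R)); last by apply/funext => w; rewrite mulr0 addr0.
  by rewrite mul1r => /eqP; rewrite addrC -subr_eq subrr eq_sym => /eqP.
elim: r => [|j r IH].
  by rewrite big_nil -I0; congr I; apply/funext => w; rewrite big_nil.
under eq_fun do rewrite big_cons; rewrite big_cons Ilin ?IH //.
by apply: quasilocal_sum => i; exact: quasilocalZ.
Qed.

Lemma mean_le I phi psi e : mean I -> quasilocal phi -> quasilocal psi ->
  (forall w, `|phi w - psi w| <= e) -> `|I phi - I psi| <= e.
Proof.
move=> [Ilin Ipos I1] H1 H2.
have half phi' psi' : quasilocal phi' -> quasilocal psi' ->
    (forall w, phi' w - psi' w <= e) -> I phi' - I psi' <= e.
  move=> H1' H2' H.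
  have q1 := quasilocalZ (-1) H1'; have q2 := quasilocalD q1 H2'.
  have := Ipos (fun w => e * 1 + (-1 * phi' w + psi' w)).
  rewrite !Ilin //; last exact: quasilocal_cst.
  rewrite I1 mulr1 mulN1r => K; have : 0 <= e + (- I phi' + I psi'); last by lra.
  apply: K => [|w]; last by have := H w; lra.
  by apply: quasilocalD => //; exact: quasilocal_cst.
move=> H; rewrite ler_norml; apply/andP; split.
  rewrite lerNl opprB; apply: half => // w.
  by have := H w; rewrite ler_norml => /andP[? ?]; lra.
by apply: half => // w; have := H w; rewrite ler_norml => /andP[? ?]; lra.
Qed.

Lemma truncate_window n m phi w : depends_on (fun k => n <= k)%N phi ->
  phi (truncate m w) = \sum_(t : {ffun 'I_m -> bool})
    phi (concat t (fun=> false)) * \1_[set x | window n m x = t] w.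
Proof.
move=> phi_n; rewrite (bigD1 (window n m w)) //= indicE mem_set // mulr1.
rewrite big1 ?addr0 => [|t tw].
  apply: phi_n => k nk; rewrite /truncate; case: ltnP => km.
    by rewrite concat_lt ffunE /= nk.
  by rewrite concat_ge.
rewrite indicE memNset ?mulr0 //= => wt; by rewrite wt eqxx in tw.
Qed.

(** A function of the spins from [n] on is uniformly approximated by its
    truncations, which are linear combinations of indicators of windows. *)
Lemma mean_ext n I I' phi : mean I -> mean I' ->
  (forall m t, I (\1_[set w | window n m w = t]) = I' (\1_[set w | window n m w = t])) ->
  quasilocal phi -> depends_on (fun k => n <= k)%N phi -> I phi = I' phi.
Proof.
move=> mI mI' II' H phi_n.
apply/eqP; rewrite -subr_eq0 -normr_le0; apply/ler_addgt0Pr => e e0.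
have e20 : 0 < e / 2 by rewrite divr_gt0.
have [m Hm] := quasilocal_approx H e20.
have ql : quasilocal (phi \o truncate m).
  by apply: (@local_quasilocal _ m); exact: depends_truncate.
have IE : I (phi \o truncate m) = I' (phi \o truncate m).
  rewrite (_ : phi \o truncate m = fun w => \sum_(t : {ffun 'I_m -> bool})
    phi (concat t (fun=> false)) * \1_[set x | window n m x = t] w); last first.
    by apply/funext => w /=; exact: truncate_window.
  rewrite !mean_sum //; try by move=> t; exact: quasilocal_window.
  by apply: eq_bigr => t _; rewrite II'.
have h1 := mean_le mI H ql Hm; have h2 := mean_le mI' H ql Hm.
rewrite add0r; move: h1 h2; rewrite IE !ler_norml => /andP[? ?] /andP[? ?].
by apply/andP; lra.
Qed.

Lemma quasilocal_measurable phi : quasilocal phi -> measurable_fun [set: config] phi.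
Proof.
move=> H; apply: (@measurable_fun_cvg _ _ _ _ (fun m => phi \o truncate m)).
  move=> m; rewrite (_ : phi \o truncate m = fun w => \sum_(t : {ffun 'I_m -> bool})
    phi (concat t (fun=> false)) * \1_[set x | window 0 m x = t] w); last first.
    apply/funext => w /=; apply: truncate_window => x y xy; congr phi.
    by apply/funext => k; exact: xy.
  apply: measurable_sum => t; apply: measurable_funM => //.
  by apply: measurable_indic; exact: (@F_le_window 0 m t).
move=> w _; apply/cvgrPdist_le => e e0; have [m0 H0] := H e e0.
exists m0 => // m /= m0m; apply: H0 => k km0; rewrite /truncate.
by rewrite (leq_trans km0 m0m).
Qed.

Section integral.
Variable mu : probability config R.

Definition expect (phi : config -> R) : R := (\int[mu]_w phi w)%R.

Lemma quasilocal_integrable phi : quasilocal phi -> mu.-integrable setT (EFin \o phi).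
Proof.
move=> H; apply: measurable_bounded_integrable => //.
- by apply: (le_lt_trans (probability_le1 mu measurableT)); exact: ltry.
- exact: quasilocal_measurable.
have [C HC] := quasilocal_bounded H.
exists C; split=> [|M CM w _ /=]; first exact: num_real.
exact: le_trans (HC w) (ltW CM).
Qed.

Lemma EFin_expect phi : quasilocal phi -> (\int[mu]_w (phi w)%:E = (expect phi)%:E)%E.
Proof.
move=> H; rewrite fineK //; apply: integrable_fin_num => //.
exact: quasilocal_integrable.
Qed.

Lemma mean_expect : mean expect.
Proof.
split=> [a phi psi H1 H2|phi _ phi0|].
- rewrite /expect RintegralD ?RintegralZl //; try exact: quasilocal_integrable.
  by apply: quasilocal_integrable; exact: quasilocalZ.
- exact: Rintegral_ge0.
- rewrite /expect Rintegral_cst // [X in fine X](_ : _ = 1%E) ?mulr1 //.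
  exact: (probability_setT mu).
Qed.

Lemma expect_event n A : window_event n A -> (mu A = (expect \1_A)%:E)%E.
Proof.
move=> HA; have ql := quasilocal_event HA.
have mA := F_le_measurable (window_event_F_le HA).
by rewrite -EFin_expect // integral_indic // setIT.
Qed.

End integral.

Lemma same_law_expect (mu nu : probability config R) :
  (forall phi, quasilocal phi -> expect mu phi = expect nu phi) -> same_law mu nu.
Proof.
move=> H A mA; suff : (measurable `&` [set A | mu A = nu A]) A by case.
apply: (@F_le_ind 0) A mA; last first.
  move=> A HA; split; first exact: F_le_measurable (window_event_F_le HA).
  by rewrite /= !(expect_event _ HA) H //; exact: quasilocal_event HA.
split=> [|A [mA /= AE]|F tF mF].
- by split=> //=; rewrite (probability_setT mu) (probability_setT nu).
- by split; [exact: measurableC | rewrite /= (probability_setC mu) // (probability_setC nu) // AE].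
split; first by apply: bigcup_measurable => k _; exact: (mF k).1.
rewrite /= !measure_bigcup //; try by move=> k _; exact: (mF k).1.
by apply: eq_eseriesr => k _; exact: (mF k).2.
Qed.

End means.

(** * Every mean is an integral *)

Section representation.
Variable R : realType.
Variable I : (config -> R) -> R.
Hypothesis mI : mean I.

Definition cylinder (n : nat) (s : config) : set config :=
  [set w | agree (fun k => k < n)%N w s].

Definition cyl_mass (n : nat) (s : config) : R := I \1_(cylinder n s).

Lemma cylinder_event n s : window_event 0 (cylinder n s).
Proof.
exists n => w w' /window_eq ww' ws k kn; rewrite -ws //; apply/esym; exact: ww'.
Qed.

Lemma cyl_mass_ge0 n s : 0 <= cyl_mass n s.
Proof.
have [_ Ipos _] := mI; apply: Ipos; first by apply: quasilocal_event; exact: cylinder_event.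
by move=> w; rewrite indicE.
Qed.

Lemma cyl_mass_agree n s s' : agree (fun k => k < n)%N s s' -> cyl_mass n s = cyl_mass n s'.
Proof.
move=> ss'; congr (I \1_ _); apply/seteqP; split => w ws k kn; first by rewrite ws // ss'.
by rewrite ws // ss'.
Qed.

Lemma cyl_mass0 s : cyl_mass 0 s = 1.
Proof.
have [_ _ <-] := mI; rewrite /cyl_mass (_ : cylinder 0 s = setT) ?indicT //.
exact/seteqP.
Qed.

Lemma agree_ltS n w s :
  agree (fun k => k < n.+1)%N w s <-> agree (fun k => k < n)%N w s /\ w n = s n.
Proof.
split=> [ws|[ws wn] k]; first by split=> [k kn|]; apply: ws => //; exact: ltnW.
by rewrite ltnS leq_eqVlt => /predU1P[->|/ws].
Qed.

Lemma set_site_lt n b (s : config) : agree (fun k => k < n)%N (set_site n b s) s.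
Proof. by move=> k kn; rewrite /set_site ltn_eqF. Qed.

Lemma set_site_at n b (s : config) : set_site n b s n = b.
Proof. by rewrite /set_site eqxx. Qed.

Lemma cylS n b s w : cylinder n.+1 (set_site n b s) w <-> cylinder n s w /\ w n = b.
Proof.
rewrite /cylinder /= agree_ltS set_site_at.
by split=> -[ws ?]; split=> // k kn; rewrite ws // set_site_lt.
Qed.

Lemma cyl_massS n s :
  cyl_mass n s = cyl_mass n.+1 (set_site n false s) + cyl_mass n.+1 (set_site n true s).
Proof.
have [Ilin _ _] := mI; have ql b := quasilocal_event (R := R) (cylinder_event n.+1 (set_site n b s)).
rewrite /cyl_mass -[X in X + _]mul1r -Ilin //; congr I; apply/funext => w; rewrite mul1r !indicE.
have [ws|nws] := pselect (cylinder n s w); last first.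
  rewrite !memNset ?addr0 //; first by move=> /cylS[].
  by move=> /cylS[].
rewrite mem_set //; case wn : (w n).
  by rewrite memNset ?mem_set ?add0r //; [apply/cylS|move=> /cylS[_]; rewrite wn].
by rewrite mem_set ?memNset ?addr0 //; [move=> /cylS[_]; rewrite wn|apply/cylS].
Qed.

(** The unit interval is cut into consecutive intervals of lengths
    [cyl_mass 1 s], each of them into intervals of lengths [cyl_mass 2 s], and so
    on; this is the left end of the interval of [s] at level [n]. *)
Fixpoint left_end (n : nat) (s : config) : R :=
  if n is n'.+1 then
    left_end n' s + (if s n' then cyl_mass n'.+1 (set_site n' false s) else 0)
  else 0.

(** The point where the interval of [s] at level [n] is divided in two. *)
Definition threshold (n : nat) (s : config) : R :=
  left_end n s + cyl_mass n.+1 (set_site n false s).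

Fixpoint prefix (x : R) (n : nat) : config :=
  if n is n'.+1 then set_site n' (threshold n' (prefix x n') <= x) (prefix x n')
  else fun=> false.

(** The configuration whose intervals all contain [x], for [x] in the interval from
    0 included to 1 excluded. *)
Definition quantile (x : R) : config := fun k => prefix x k.+1 k.

Lemma left_end_agree n s s' :
  agree (fun k => k < n)%N s s' -> left_end n s = left_end n s'.
Proof.
elim: n => //= n IH /agree_ltS[ss' sn]; rewrite IH // sn; congr (_ + _).
case: ifP => // _; apply: cyl_mass_agree => k; rewrite ltnS /set_site.
by case: eqP => // /eqP kn kn'; apply: ss'; rewrite ltn_neqAle kn.
Qed.

Lemma threshold_agree n s s' :
  agree (fun k => k < n)%N s s' -> threshold n s = threshold n s'.
Proof.
move=> ss'; congr (_ + _); first exact: left_end_agree.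
apply: cyl_mass_agree => k; rewrite ltnS /set_site.
by case: eqP => // /eqP kn kn'; apply: ss'; rewrite ltn_neqAle kn.
Qed.

Lemma prefix_quantile x n : agree (fun k => k < n)%N (prefix x n) (quantile x).
Proof.
elim: n => // n IH; apply/agree_ltS; split => // k kn.
by rewrite -(IH _ kn) /=; exact: set_site_lt.
Qed.

Lemma quantile_at x n : quantile x n = (threshold n (quantile x) <= x).
Proof.
by rewrite /quantile /= set_site_at (threshold_agree (@prefix_quantile x n)).
Qed.

Lemma cylinder_interval n s :
  0 <= left_end n s /\ left_end n s + cyl_mass n s <= 1.
Proof.
elim: n => /= [|n [IH0 IH1]]; first by rewrite cyl_mass0 add0r.
have c1 := cyl_mass_ge0 n.+1 (set_site n false s).
have c2 := cyl_mass_ge0 n.+1 (set_site n true s).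
have := cyl_massS n s => E; have -> : cyl_mass n.+1 s = cyl_mass n.+1 (set_site n (s n) s).
  apply: cyl_mass_agree; apply/agree_ltS; rewrite set_site_at; split=> // k kn.
  by rewrite set_site_lt.
by case: (s n); split; lra.
Qed.

Lemma quantile_cylinder x n s : 0 <= x < 1 ->
  cylinder n s (quantile x) <-> left_end n s <= x < left_end n s + cyl_mass n s.
Proof.
move=> x01; elim: n => /= [|n IH]; first by rewrite cyl_mass0 add0r x01; split.
rewrite /cylinder /= agree_ltS -/(cylinder n s (quantile x)).
have c1 := cyl_mass_ge0 n.+1 (set_site n false s).
have c2 := cyl_mass_ge0 n.+1 (set_site n true s).
have := cyl_massS n s => E; have -> : cyl_mass n.+1 s = cyl_mass n.+1 (set_site n (s n) s).
  apply: cyl_mass_agree; apply/agree_ltS; rewrite set_site_at; split=> // k kn.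
  by rewrite set_site_lt.
split=> [[qs]|H].
  rewrite quantile_at (threshold_agree qs) /threshold => H.
  by move/IH: qs; case: (s n) H => [|/negbT]; rewrite -?ltNge => ? /andP[? ?];
    apply/andP; split; lra.
have qs : cylinder n s (quantile x).
  by apply/IH; move: H; case: (s n) => /andP[? ?]; apply/andP; split; lra.
split=> //; rewrite quantile_at (threshold_agree qs) /threshold.
move: H; case: (s n) => /andP[? ?]; first lra.
by apply/negbTE; rewrite -ltNge; lra.
Qed.

Lemma quantile_cylinder_measurable n s : measurable [set x | cylinder n s (quantile x)].
Proof.
elim: n => [|n IH]; first by rewrite (_ : mkset _ = setT) // -subTset.
rewrite (_ : mkset _ = [set x | cylinder n s (quantile x)] `&`
   [set x | (threshold n s <= x) = s n]); last first.
  rewrite /cylinder; apply/seteqP; split => x /=; rewrite agree_ltS quantile_at.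
    by move=> [qs]; rewrite (threshold_agree qs).
  by move=> [qs]; rewrite (threshold_agree qs).
apply: measurableI => //; case: (s n).
  rewrite (_ : mkset _ = `[threshold n s, +oo[%classic); first exact: measurable_itv.
  by apply/seteqP; split => x /=; rewrite in_itv /= andbT.
rewrite (_ : mkset _ = `]-oo, threshold n s[%classic); first exact: measurable_itv.
by apply/seteqP; split => x /=; rewrite in_itv /= ltNge; [move=> ->|move/negbTE].
Qed.

Lemma quantile_measurable : measurable_fun [set: R] (quantile : R -> config).
Proof.
apply: (@measurability _ _ R config setT quantile (coord_events 0)) => // _ [_ [k _ [C mC <-]] <-].
rewrite !setTI (_ : _ @^-1` _ = [set x | C (quantile x k)]) //.
rewrite (_ : mkset _ = \bigcup_(t in [set t : {ffun 'I_k.+1 -> bool} | C (t ord_max)])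
  [set x | cylinder k.+1 (concat t (fun=> false)) (quantile x)]); last first.
  apply/seteqP; split => x /=.
    move=> Cx; exists (window 0 k.+1 (quantile x)); first by rewrite /= ffunE.
    by move=> j jk; rewrite concat_lt ffunE.
  move=> [t /= Ct]; rewrite /cylinder /= agree_ltS concat_lt => -[_ ->].
  by rewrite (_ : Ordinal _ = ord_max) //; exact: val_inj.
apply: fin_bigcup_measurable; first exact: finite_finset.
by move=> t _; exact: quantile_cylinder_measurable.
Qed.

Definition quantile_mfun : {mfun measurableTypeR R >-> config} :=
  HB.pack (quantile : measurableTypeR R -> config)
    (isMeasurableFun.Build _ _ (measurableTypeR R) config quantile quantile_measurable).

Definition representing_probability : probability config R :=
  distribution (uniform_prob (@ltr01 R)) quantile_mfun.

Lemma representing_cylinder n s :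
  (representing_probability (cylinder n s) = (cyl_mass n s)%:E)%E.
Proof.
set P := uniform_prob (@ltr01 R); set A := quantile @^-1` cylinder n s.
have mA : measurable A := quantile_cylinder_measurable n s.
have -> : representing_probability (cylinder n s) = P A by [].
have -> : P A = (\int[P]_x (\1_A x)%:E)%E by rewrite integral_indic // setIT.
have mf D : measurable_fun D (fun x : R => (\1_A x)%:E : \bar R).
  by apply/measurable_EFinP; exact: measurable_indic.
(* The uniform distribution lives on the closed interval; the point 1, where the
   cylinders are not given by their intervals, is dropped as it is negligible. *)
rewrite integral_uniform; [|exact: mf|by move=> x; rewrite lee_fin indicE].
rewrite subr0 invr1 mul1e -integral_itv_bndo_bndc // integral_indic //.
rewrite (_ : A `&` _ = `[left_end n s, left_end n s + cyl_mass n s[%classic).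
  have : lebesgue_measure (`[left_end n s, left_end n s + cyl_mass n s[%classic : set R) =
      (cyl_mass n s)%:E; last by [].
  rewrite lebesgue_measure_itv /= lte_fin ltrDl -EFinB addrAC subrr add0r.
  case: ltP => // c0; congr (_%:E).
  by apply/le_anti; rewrite c0 cyl_mass_ge0.
have [l0 l1] := cylinder_interval n s.
apply/seteqP; split => x /=; rewrite !in_itv /=.
  by move=> [qx x01]; apply/quantile_cylinder.
move=> /andP[lx xr]; have x01 : 0 <= x < 1 by apply/andP; split; lra.
by split=> //; apply/(quantile_cylinder _ _ x01); rewrite lx.
Qed.

(** The image of the uniform distribution under [quantile] gives every cylinder the
    length of its interval, which is the value of the mean at its indicator. *)
Lemma mean_representation : exists mu : probability config R,
  forall phi, quasilocal phi -> expect mu phi = I phi.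
Proof.
exists representing_probability => phi H.
apply: (mean_ext (n := 0) (mean_expect _) mI) => // [m t|w w' ww']; last first.
  by congr phi; apply/funext => k; exact: ww'.
have E : [set w | window 0 m w = t] = cylinder m (concat t (fun=> false)).
  apply/seteqP; split => w /= => [<- k km|wt]; first by rewrite concat_lt ffunE.
  by apply/ffunP => i; rewrite ffunE /= wt // concat_lt; congr (t _); exact: val_inj.
apply: EFin_inj; rewrite E -(expect_event _ (cylinder_event _ _)).
exact: representing_cylinder.
Qed.

End representation.

(** * Existence and uniqueness of the state *)

Section unique_state.
Variables (R : realType) (K T : nat -> R) (h : nat -> config -> R).
Hypothesis K_ge0 : forall r, 0 <= K r.+1.
Hypothesis T_rec : forall r, T r = K r.+1 + T r.+1.
Hypothesis T_cvg : T @ \oo --> (0 : R).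
Hypothesis h_tail : forall i r w, `|h i w - pair_energy K i r w| <= T r.
Hypothesis renewal_divergence : forall A : R, exists n,
  A <= \sum_(i < n) \prod_(r < i) expR (- (4 * T r)).
Variable phi : potential R.
Hypothesis weightE : forall n w, weight phi n w = gibbs_weight h n.+1 w.

Local Notation resample := (resample h).
Local Notation conditional := (conditional h).
Local Notation limit_state := (limit_state h).

Lemma transitionE n w : transition phi n w = conditional n w.
Proof. by congr (_ / _); apply: eq_bigr => s _; rewrite weightE. Qed.

Lemma lss_kernelE n w A : lss_kernel phi n w A = (resample n \1_A w)%:E.
Proof.
rewrite /lss_kernel /resample -sumEFin; apply: eq_bigr => b _.
by rewrite transitionE EFinM.
Qed.

Lemma set_site_measurable n b : measurable_fun [set: config] (set_site n b).
Proof.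
apply: (@measurability _ _ config config setT (set_site n b) (coord_events 0)) => //.
move=> _ [_ [k k0 [C mC <-]] <-]; rewrite !setTI.
have [kn|kn] := eqVneq k n; last first.
  rewrite [X in measurable X](_ : _ = [set w | C (w k)]).
    by apply: sub_sigma_algebra; exists k => //; exists C => //; rewrite setTI.
  by apply/seteqP; split => w /=; rewrite /preimage /= /set_site (negbTE kn).
have [Cb|nCb] := pselect (C b).
  rewrite [X in measurable X](_ : _ = setT) // -subTset => w _.
  by rewrite /preimage /= /set_site kn eqxx.
rewrite [X in measurable X](_ : _ = set0) // -subset0 => w.
by rewrite /preimage /= /set_site kn eqxx.
Qed.

Lemma resample_cst n c w : resample n (fun=> c) w = c.
Proof.
by rewrite /resample -mulr_suml (conditional_sum T_cvg h_tail) mul1r.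
Qed.

Lemma resampleD n a psi psi' w :
  resample n (fun x => a * psi x + psi' x) w = a * resample n psi w + resample n psi' w.
Proof. by rewrite /resample mulr_sumr -big_split; apply: eq_bigr => b _ /=; ring. Qed.

Lemma resample_ge0 n psi w : (forall x, 0 <= psi x) -> 0 <= resample n psi w.
Proof. by move=> H; apply: sumr_ge0 => b _; rewrite mulr_ge0 // conditional_ge0. Qed.

Lemma resample_indic n A w : 0 <= resample n (\1_A) w <= 1.
Proof.
apply/andP; split; first by apply: resample_ge0 => x; rewrite indicE.
rewrite -[leRHS](resample_cst n 1 w); apply: ler_sum => b _.
by rewrite ler_wpM2l ?conditional_ge0 // indicE; case: (_ \in _).
Qed.

Lemma resample_measurable n A : measurable (A : set config) ->
  measurable_fun [set: config] (resample n \1_A : config -> R).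
Proof.
move=> mA; apply: measurable_sum => b; apply: measurable_funM.
  apply: quasilocal_measurable; apply: (quasilocal_comp (f := set_site n b)).
    by move=> m w w'; exact: agree_set_site.
  exact: quasilocal_conditional T_cvg h_tail _.
apply: (measurableT_comp (f := (\1_A : config -> R))).
  exact: measurable_indic.
exact: set_site_measurable.
Qed.

Lemma lss_kernel_bigcup n w (F : nat -> set config) :
  trivIset setT F -> (forall k, measurable (F k)) ->
  (lss_kernel phi n w (\bigcup_k F k) = \sum_(0 <= k <oo) lss_kernel phi n w (F k))%E.
Proof.
move=> tF mF; rewrite /lss_kernel nneseries_sum; last first.
  move=> b j _; rewrite mule_ge0 // lee_fin.
  by rewrite transitionE conditional_ge0.
apply: eq_bigr => b _; rewrite nneseriesZl // measure_bigcup //.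
by congr (_ * _)%E; apply: eq_eseriesl => k; rewrite mem_setT.
Qed.

(** The events for which the defining equation of a state holds form a Dynkin
    system, so that the pi-system of window events suffices. *)
Lemma lss_state_of_events (mu : probability config R) :
  (forall n A, window_event n A -> expect mu (resample n \1_A) = expect mu \1_A) ->
  lss_states (lss_kernel phi) mu.
Proof.
move=> H n A FA.
pose D := measurable `&` [set A : set config | (\int[mu]_w lss_kernel phi n w A = mu A)%E].
suff : D A by case.
apply: F_le_ind A FA; last first.
  move=> A HA; split; first exact: F_le_measurable (window_event_F_le HA).
  rewrite /= (expect_event mu HA) -(H _ _ HA).
  under eq_integral do rewrite lss_kernelE.
  apply: EFin_expect; apply: quasilocal_resample T_cvg h_tail _ _ _.
  exact: quasilocal_event HA.
split=> [|A [mA /= AE]|F tF mF].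
- split=> //=; under eq_integral do rewrite lss_kernelE indicT resample_cst.
  by rewrite integral_cst // mul1e.
- split; [exact: measurableC|rewrite /= (probability_setC mu) // -AE].
  have ql1 := quasilocal_integrable mu (quasilocal_cst 1).
  have int : mu.-integrable setT (EFin \o resample n \1_A).
    apply: measurable_bounded_integrable => //.
    + by apply: (le_lt_trans (probability_le1 mu measurableT)); exact: ltry.
    + exact: resample_measurable.
    exists 1; split=> [|M M1 w _ /=]; first exact: num_real.
    have /andP[? ?] := resample_indic n A w.
    by rewrite ger0_norm //; apply: ltW; apply: le_lt_trans M1.
  under eq_integral => w _.
    rewrite lss_kernelE (_ : \1_(~` A) = fun w => -1 * \1_A w + 1); last first.
      apply/funext => x; rewrite !indicE; have [Ax|nAx] := pselect (A x).
        by rewrite memNset ?mem_set ?mulr1 ?addNr // => /(_ Ax).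
      by rewrite mem_set ?memNset ?mulr0 ?add0r.
    rewrite resampleD resample_cst mulN1r addrC EFinB; over.
  rewrite integralB_EFin // integral_cst // mul1e.
  congr (_ - _)%E; first exact: (probability_setT mu).
  by apply: eq_integral => w _; rewrite lss_kernelE.
split; first by apply: bigcup_measurable => k _; exact: (mF k).1.
have mF' k : measurable (F k) := (mF k).1.
rewrite /=; under [LHS]eq_integral do rewrite lss_kernel_bigcup //.
rewrite integral_nneseries //; last 2 first.
- move=> k; rewrite (_ : _ ^~ (F k) = EFin \o resample n \1_(F k)).
    by apply/measurable_EFinP; exact: resample_measurable.
  by apply/funext => w; rewrite lss_kernelE.
- by move=> k w _; rewrite lss_kernelE lee_fin; case/andP: (resample_indic n (F k) w).
rewrite measure_bigcup //; under [RHS]eq_eseriesl do rewrite mem_setT.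
by apply: eq_eseriesr => k _; exact: (mF k).2.
Qed.

Lemma limit_state_mean : mean limit_state.
Proof.
split=> [a psi psi' H1 H2|psi H|].
- exact: (limit_stateD K_ge0 T_rec T_cvg h_tail renewal_divergence).
- exact: (limit_state_ge0 K_ge0 T_rec T_cvg h_tail renewal_divergence).
- exact: (limit_state_cst K_ge0 T_rec T_cvg h_tail renewal_divergence).
Qed.

Section any_state.
Variable nu : probability config R.
Hypothesis nu_state : lss_states (lss_kernel phi) nu.

(** The defining equation of a state concerns events; it extends to functions as
    both sides are means in [psi] that agree on windows. *)
Lemma expect_resample n psi : quasilocal psi -> depends_on (fun k => n <= k)%N psi ->
  expect nu (resample n psi) = expect nu psi.
Proof.
have [Elin Epos E1] := mean_expect nu.
have ql := @quasilocal_resample R K T h T_cvg h_tail n.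
apply: (@mean_ext R n (fun psi => expect nu (resample n psi))).
- split=> [a f g Hf Hg|f Hf f0|].
  + by rewrite -Elin; [|exact: ql|exact: ql]; congr (expect nu _); apply/funext => w; rewrite resampleD.
  + by apply: Epos => [|w]; [exact: ql|exact: resample_ge0].
  + by rewrite -[RHS]E1; congr (expect nu _); apply/funext => w; rewrite resample_cst.
- exact: mean_expect.
move=> m t; have HA := window_event_set n t.
apply: EFin_inj; rewrite -(expect_event _ HA).
rewrite -(nu_state (@F_le_window n m t)) -EFin_expect; last first.
  exact: (ql _ (quasilocal_event HA)).
by apply: eq_integral => w _; rewrite lss_kernelE.
Qed.

Lemma expect_gibbs n psi : quasilocal psi -> expect nu (gibbs h n psi) = expect nu psi.
Proof.
move=> H; elim: n => [|n IH]; first by rewrite (gibbs0 h).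
rewrite (_ : gibbs h n.+1 psi = resample n (gibbs h n psi)); last first.
  by apply/funext => w; rewrite (resample_gibbs T_cvg h_tail).
rewrite expect_resample ?IH //; last exact: gibbs_past.
exact: (quasilocal_gibbs T_cvg h_tail).
Qed.

(** By [expect_gibbs], [nu] averages expectations at volume [n], which are all close
    to the limit. *)
Lemma expect_limit psi : quasilocal psi -> expect nu psi = limit_state psi.
Proof.
move=> H; apply/eqP; rewrite -subr_eq0 -normr_le0; apply/ler_addgt0Pr => e e0.
have [n Hn] := gibbs_cvg K_ge0 T_rec T_cvg h_tail renewal_divergence H e0.
have -> : limit_state psi = expect nu (fun=> limit_state psi).
  by rewrite /expect Rintegral_cst // [X in fine X](_ : _ = 1%E) ?mulr1 //;
    exact: (probability_setT nu).
rewrite add0r -(expect_gibbs n H); apply: mean_le (mean_expect nu) _ _ _.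
- exact: (quasilocal_gibbs T_cvg h_tail).
- exact: quasilocal_cst.
- by move=> w; exact: Hn.
Qed.

End any_state.

Theorem unique_state_of_renewal : unique_state (lss_kernel phi).
Proof.
have [mu Hmu] := mean_representation limit_state_mean.
exists mu => [|nu Hnu]; last first.
  by apply: same_law_expect => psi H; rewrite Hmu // expect_limit.
apply: lss_state_of_events => n A HA; have H := quasilocal_event (R := R) HA.
rewrite !Hmu //; last exact: (quasilocal_resample T_cvg h_tail).
apply: (limit_state_resample K_ge0 T_rec T_cvg h_tail renewal_divergence) => //.
exact: depends_event.
Qed.

End unique_state.

(** * Energies as sums over finite sets of sites *)

Section tails.
Variables (R : realType) (k : nat -> R).
Hypothesis k_ge0 : forall q, 0 <= k q.
Hypothesis k_sum : (\sum_(0 <= q <oo) (k q)%:E < +oo)%E.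

Definition tail (f : nat -> R) (r : nat) : R := fine (\sum_(r <= q <oo) (f q)%:E)%E.

Lemma EFin_tail f r : (forall q, 0 <= f q <= k q) ->
  ((tail f r)%:E = \sum_(r <= q <oo) (f q)%:E)%E.
Proof.
move=> fk; have f0 q : (0 <= (f q)%:E)%E by rewrite lee_fin; case/andP: (fk q).
rewrite fineK // ge0_fin_numE; last exact: nneseries_ge0.
apply: le_lt_trans k_sum; apply: le_trans (_ : (\sum_(0 <= q <oo) (f q)%:E <= _)%E).
  by rewrite [leRHS](nneseries_split 0 r) // add0n leeDr // sume_ge0.
by apply: lee_nneseries => // q _; rewrite lee_fin; case/andP: (fk q).
Qed.

Lemma tail_split f r : (forall q, 0 <= f q <= k q) ->
  tail f 0 = \sum_(q < r) f q + tail f r.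
Proof.
move=> fk; apply: EFin_inj; rewrite EFinD !EFin_tail // (nneseries_split 0 r).
  by rewrite add0n sumEFin big_mkord.
by move=> q _; rewrite lee_fin; case/andP: (fk q).
Qed.

Lemma tail_ge0 f r : (forall q, 0 <= f q <= k q) -> 0 <= tail f r.
Proof.
move=> fk; apply: fine_ge0; apply: nneseries_ge0 => q _ _.
by rewrite lee_fin; case/andP: (fk q).
Qed.

Lemma tailD f g r : (forall q, 0 <= f q) -> (forall q, 0 <= g q) ->
  (forall q, f q + g q = k q) -> tail f r + tail g r = tail k r.
Proof.
move=> f0 g0 fg; apply: EFin_inj; rewrite EFinD !EFin_tail; first last.
- by move=> q; rewrite -fg f0 lerDl g0.
- by move=> q; rewrite -fg g0 lerDr f0.
- by move=> q; rewrite k_ge0 lexx.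
rewrite -nneseriesD; try by move=> q _ _; rewrite lee_fin.
by apply: eq_eseriesr => q _; rewrite -EFinD fg.
Qed.

Let kk q : 0 <= k q <= k q. Proof. by rewrite k_ge0 lexx. Qed.

Lemma tail_rec r : tail k r = k r + tail k r.+1.
Proof.
by have := tail_split r kk; have := tail_split r.+1 kk; rewrite big_ord_recr /=; lra.
Qed.

Lemma tail_cvg : tail k @ \oo --> (0 : R).
Proof.
have := nneseries_tail_cvg (P := xpredT) k_sum (fun q _ => k_ge0 q).
under eq_cvg do rewrite -EFin_tail //.
by move=> /fine_cvgP[].
Qed.

(** The value of [rsum] for a family indexed by the natural numbers. *)
Definition signed_sum (x : nat -> R) : R :=
  tail (fun q => Num.max (x q) 0) 0 - tail (fun q => Num.max (- x q) 0) 0.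

Lemma max_parts (x : R) : Num.max x 0 - Num.max (- x) 0 = x /\
  Num.max x 0 + Num.max (- x) 0 = `|x|.
Proof.
have [x0|x0] := leP 0 x.
  by rewrite max_r ?oppr_le0 // subr0 addr0 ger0_norm.
by rewrite max_l ?oppr_ge0 ?ltW // sub0r opprK add0r ltr0_norm.
Qed.

(** The tails of the positive and of the negative parts are nonnegative and add up
    to [tail k r]. *)
Lemma signed_sum_tail x r : (forall q, `|x q| = k q) ->
  `|signed_sum x - \sum_(q < r) x q| <= tail k r.
Proof.
move=> xk; pose P q := Num.max (x q) 0; pose M q := Num.max (- x q) 0.
have P0 q : 0 <= P q by rewrite /P le_max lexx orbT.
have M0 q : 0 <= M q by rewrite /M le_max lexx orbT.
have PM q : P q + M q = k q by rewrite -xk; case: (max_parts (x q)).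
have Pk q : 0 <= P q <= k q by rewrite -PM P0 lerDl M0.
have Mk q : 0 <= M q <= k q by rewrite -PM M0 lerDr P0.
have -> : \sum_(q < r) x q = \sum_(q < r) P q - \sum_(q < r) M q.
  by rewrite -sumrB; apply: eq_bigr => q _; case: (max_parts (x q)).
rewrite /signed_sum (tail_split r Pk) (tail_split r Mk).
have := tailD r P0 M0 PM; have := tail_ge0 r Pk; have := tail_ge0 r Mk.
by rewrite ler_norml => ? ? ?; apply/andP; split; lra.
Qed.

End tails.

Section ising_weight.
Variables (R : realType) (J : nat -> R) (beta : R).
Hypothesis J_ge0 : forall r, (1 <= r)%N -> 0 <= J r.
Hypothesis J_sum : (\sum_(1 <= r <oo) (J r)%:E < +oo)%E.
Hypothesis beta_gt0 : 0 < beta.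

Let strength q := beta * J q.+1.

Definition ising_field (i : nat) (w : config) : R :=
  signed_sum (fun q => strength q * (spin R (w i) * spin R (w (i + q.+1)%N))).

Lemma strength_ge0 q : 0 <= strength q.
Proof. by apply: mulr_ge0; [exact: ltW | exact: J_ge0]. Qed.

Lemma strength_sum : (\sum_(0 <= q <oo) (strength q)%:E < +oo)%E.
Proof.
have -> : (\sum_(0 <= q <oo) (strength q)%:E = beta%:E * \sum_(1 <= r <oo) (J r)%:E)%E.
  have -> : (\sum_(1 <= r <oo) (J r)%:E = \sum_(1 <= r <oo) (`|J r|%R)%:E)%E.
    rewrite eseries_cond [RHS]eseries_cond; apply: eq_eseriesr => r /= r1.
    by rewrite ger0_norm // J_ge0.
  rewrite -[X in (_ * X)%E]nneseries_addn => [|i]; last by rewrite lee_fin normr_ge0.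
  rewrite -[RHS]nneseriesZl => [|i _]; last by rewrite lee_fin normr_ge0.
  by apply: eq_eseriesr => q _; rewrite addn1 -EFinM ger0_norm // J_ge0.
by rewrite lte_mul_pinfty // lee_fin ltW.
Qed.

Lemma ising_field_tail i r w :
  `|ising_field i w - pair_energy (fun r => beta * J r) i r w| <= tail strength r.
Proof.
apply: signed_sum_tail; [exact: strength_ge0|exact: strength_sum|].
by move=> q; rewrite normrM norm_spin2 mulr1 ger0_norm // strength_ge0.
Qed.

Lemma enum_pair (i j : nat) : i != j ->
  enum_fset [fset i; j]%fset = [:: i; j] \/ enum_fset [fset i; j]%fset = [:: j; i].
Proof.
move=> ij; have u := fset_uniq [fset i; j]%fset.
have m x : (x \in enum_fset [fset i; j]%fset) = (x == i) || (x == j).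
  by rewrite -[LHS]/(x \in [fset i; j]%fset) !inE.
have : perm_eq (enum_fset [fset i; j]%fset) [:: i; j].
  apply: uniq_perm => //; first by rewrite /= inE ij.
  by move=> x; rewrite m !inE.
case: (enum_fset _) u m => [|a [|b [|c s]]] u m p; have := perm_size p => //= _.
have := m a; have := m b; rewrite !inE !eqxx ?orbT => /esym/orP[]/eqP bE /esym/orP[]/eqP aE.
- by move: u; rewrite /= inE aE bE eqxx.
- by right; rewrite aE bE.
- by left; rewrite aE bE.
- by move: u; rewrite /= inE aE bE eqxx.
Qed.

Lemma ising_potential_pair i q w :
  ising_potential (distance_coupling J) beta [fset i; (i + q.+1)%N]%fset w =
  - (strength q * (spin R (w i) * spin R (w (i + q.+1)%N))).
Proof.
have ij : i != (i + q.+1)%N by lia.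
have d1 : `|i%:Z - (i + q.+1)%N%:Z|%N = q.+1 by lia.
have d2 : `|(i + q.+1)%N%:Z - i%:Z|%N = q.+1 by lia.
rewrite /ising_potential /distance_coupling /strength.
by case: (enum_pair ij) => ->; rewrite ?d1 ?d2; ring.
Qed.

Lemma ising_potential_nonpair A w :
  (forall i q, A != [fset i; (i + q.+1)%N]%fset) ->
  ising_potential (distance_coupling J) beta A w = 0.
Proof.
move=> HA; rewrite /ising_potential; have := fset_uniq A.
case E : (enum_fset A) => [|i [|j [|? ?]]] //=; rewrite inE andbT => ij.
have AE : A = [fset i; j]%fset.
  by apply/fsetP => x; rewrite -[LHS]/(x \in enum_fset A) E !inE.
have [lt|gt|eq] := ltngtP i j.
- by have := HA i (j - i.+1)%N; rewrite AE (_ : (i + _)%N = j) ?eqxx //; lia.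
- have := HA j (i - j.+1)%N; rewrite AE (_ : (j + _)%N = i); last lia.
  by rewrite fsetUC eqxx.
- by rewrite eq eqxx in ij.
Qed.

(** The sets with nonzero interaction that meet the first [n.+1] sites are the pairs
    {i, i + q + 1} with [i <= n], each counted once through its least element. *)
Lemma esum_pairs n (g : {fset nat} -> \bar R) : (forall A, 0 <= g A)%E ->
  (forall A, (forall i q, A != [fset i; (i + q.+1)%N]%fset) -> g A = 0%E) ->
  (\esum_(A in [set A : {fset nat} | exists2 k, k \in A & (k <= n)%N]) g A =
   \sum_(i < n.+1) \sum_(0 <= q <oo) g [fset (i : nat); (i + q.+1)%N]%fset)%E.
Proof.
move=> g0 gN; pose e (p : nat * nat) := [fset p.1; (p.1 + p.2.+1)%N]%fset.
have e_inj : set_inj (`I_n.+1 `*`` (fun=> [set: nat])) e.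
  move=> [i q] [i' q'] _ _ /fsetP E.
  have := E i; have := E (i + q.+1)%N; have := E i'; have := E (i' + q'.+1)%N.
  rewrite !inE !eqxx ?orbT /= => h1 h2 h3 h4; congr (_, _); lia.
rewrite esum_mkcond.
transitivity (\esum_(A in e @` (`I_n.+1 `*`` (fun=> [set: nat]))) g A)%E.
  rewrite [RHS]esum_mkcond; apply: eq_esum => A _.
  have [[i [q AE]]|nA] := pselect (exists i q, A = [fset i; (i + q.+1)%N]%fset); last first.
    rewrite gN; first by case: ifP; case: ifP.
    by move=> i q; apply/eqP => AE; apply: nA; exists i, q.
  congr (if _ then _ else _); apply/idP/idP; rewrite !inE => /=.
    move=> [j]; rewrite AE !inE => /orP[]/eqP -> jn; exists (i, q) => //=; lia.
  move=> [[i' q'] /= [i'n _] <-]; exists i' => //; first by rewrite !inE eqxx.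
rewrite esum_image // -(esum_esum (a := fun i q => g (e (i, q)))) //.
rewrite esum_fset; [|exact: finite_II|by move=> i _; exact: esum_ge0].
rewrite -fsbig_ord.
by apply: eq_bigr => i _; rewrite nneseries_esumT.
Qed.

Lemma ising_weightE n w :
  weight (ising_potential (distance_coupling J) beta) n w =
  gibbs_weight ising_field n.+1 w.
Proof.
congr expR; rewrite /rsum opprB.
pose x i q := strength q * (spin R (w i) * spin R (w (i + q.+1)%N)).
have xk i q : `|x i q| = strength q by rewrite normrM norm_spin2 mulr1 ger0_norm // strength_ge0.
have p0 (s : R) : (0 <= (Num.max s 0)%:E)%E by rewrite lee_fin le_max lexx orbT.
rewrite (@esum_pairs n (fun A => (Num.max
    (- ising_potential (distance_coupling J) beta A w) 0)%:E)) //; last first.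
  by move=> A HA; rewrite ising_potential_nonpair // oppr0 maxxx.
rewrite (@esum_pairs n (fun A => (Num.max
    (ising_potential (distance_coupling J) beta A w) 0)%:E)) //; last first.
  by move=> A HA; rewrite ising_potential_nonpair // maxxx.
have E (f : nat -> nat -> R) : (forall i q, 0 <= f i q <= strength q) ->
    fine (\sum_(i < n.+1) \sum_(0 <= q <oo) (f i q)%:E)%E = \sum_(i < n.+1) tail (f i) 0.
  move=> fk; apply: EFin_inj; rewrite -sumEFin.
  under eq_bigr => i _ do rewrite -(EFin_tail strength_sum 0 (fk i)).
  by rewrite sumEFin.
have xE i q : x i q = - ising_potential (distance_coupling J) beta [fset i; (i + q.+1)%N]%fset w.
  by rewrite ising_potential_pair opprK.
have mx (y : R) : 0 <= Num.max y 0 <= `|y|.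
  by rewrite ge_max ler_norm normr_ge0 le_max lexx orbT.
pose ip i q := ising_potential (distance_coupling J) beta [fset i; (i + q.+1)%N]%fset w.
rewrite (E (fun i q => Num.max (- ip i q) 0)); last first.
  by move=> i q; rewrite -xE -(xk i).
rewrite (E (fun i q => Num.max (ip i q) 0)); last first.
  by move=> i q; rewrite -[ip i q]opprK -xE -(xk i q) -normrN.
rewrite -sumrB; apply: eq_bigr => i _; rewrite /ising_field /signed_sum.
by congr (tail _ 0 - tail _ 0); apply/funext => q; rewrite -/(x _ _) xE ?opprK.
Qed.

End ising_weight.

(** * Couplings of order 1 / (r^2 log r) *)

Section estimates.
Variable R : realType.

Lemma ln_diff (x y : R) : 0 < x -> x <= y -> ln y - ln x <= (y - x) / x.
Proof.
move=> x0 xy; have y0 := lt_le_trans x0 xy.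
rewrite -ln_div ?posrE //; have -> : y / x = 1 + (y - x) / x by field; rewrite gt_eqF.
apply: le_ln1Dx; apply: lt_le_trans (_ : 0 <= _); first by rewrite ltrN10.
by rewrite divr_ge0 ?subr_ge0 // ltW.
Qed.

Lemma ln_diffS (i : nat) : (0 < i)%N -> ln i.+1%:R - ln i%:R <= (i%:R)^-1 :> R.
Proof.
move=> i0; have ip : 0 < i%:R :> R by rewrite ltr0n.
apply: le_trans (ln_diff ip _) _; first by rewrite ler_nat.
by rewrite -natr1 addrC addKr mul1r.
Qed.

Lemma ln_large (B : R) : exists n0, forall n, (n0 <= n)%N -> B <= ln n%:R.
Proof.
exists (Num.truncn (expR B)).+1 => n nn; rewrite -[B]expRK ler_ln ?posrE ?expR_gt0 //.
  by apply: ltW; apply: lt_le_trans (truncnS_gt _) _; rewrite ler_nat.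
by rewrite ltr0n; exact: leq_trans nn.
Qed.

Lemma ln_gt0_nat (n : nat) : (2 <= n)%N -> 0 < ln n%:R :> R.
Proof. by move=> n2; rewrite ln_gt0 // ltr1n. Qed.

(** As exp(-x) >= 1 - x, the hypothesis makes [r * u r] nondecreasing for
    [m <= r], where [u] denotes the product; hence [u] dominates a multiple of the
    harmonic sequence. *)
Lemma renewal_divergence_of_tail (T : nat -> R) m : (0 < m)%N ->
  (forall r, 0 <= T r) ->
  (forall r, (m <= r)%N -> 4 * T r <= (r.+1%:R)^-1) ->
  forall A, exists n, A <= \sum_(i < n) \prod_(r < i) expR (- (4 * T r)).
Proof.
move=> m0 T0 Tm A; pose u i : R := \prod_(r < i) expR (- (4 * T r)).
have u0 i : 0 < u i by apply: prodr_gt0 => *; exact: expR_gt0.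
pose c := m%:R * u m; have c0 : 0 < c by rewrite mulr_gt0 ?ltr0n.
have uc i : (m <= i)%N -> c / i%:R <= u i.
  move=> mi; have i0 : (0 < i)%N by exact: leq_trans mi.
  rewrite ler_pdivrMr ?ltr0n // mulrC; move: mi; rewrite /c => /subnKC <-.
  elim: (i - m)%N => [|j IH]; first by rewrite addn0.
  apply: le_trans IH _; rewrite addnS [u _.+1]/u big_ord_recr /= -/(u _).
  set r := (m + j)%N; rewrite mulrCA mulrC mulrA -[leLHS]mulr1 -mulrA.
  have r0 : 0 < r.+1%:R :> R by rewrite ltr0n.
  have H : r%:R <= r.+1%:R * expR (- (4 * T r)).
    apply: le_trans (_ : r.+1%:R * (1 - (r.+1%:R)^-1) <= _).
      by rewrite mulrBr mulr1 divff ?gt_eqF // -natr1 addrK.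
    apply: ler_wpM2l; first exact: ltW.
    apply: le_trans (expR_ge1Dx _).
    by rewrite lerD2l lerN2 Tm // leq_addr.
  by have := u0 r; nra.
have [n Hn] := ln_large (A / c + ln m%:R).
exists (maxn n m); rewrite -(big_mkord xpredT u).
have mn := leq_maxr n m; have nn := leq_maxl n m; move: (maxn n m) mn nn => N mN nN.
rewrite (big_cat_nat (leq0n m) mN) //= -[leLHS]add0r lerD //; first by apply: sumr_ge0 => i _; exact: ltW.
apply: le_trans (_ : c * (ln N%:R - ln m%:R) <= _).
  by rewrite mulrC -ler_pdivrMr // lerBrDr; exact: Hn.
rewrite -(telescope_sumr (fun i => ln i%:R)) // mulr_sumr; apply: ler_sum_nat => i /andP[mi _].
apply: le_trans (uc _ mi); apply: ler_wpM2l; first exact: ltW.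
    apply: ln_diffS.
exact: leq_trans mi.
Qed.

Section log_coupling.
Variables (a : R) (J : nat -> R).
Hypothesis a_gt0 : 0 < a.
Hypothesis J1_ge0 : 0 <= J 1%N.
Hypothesis JE : forall r : nat, (2 <= r)%N -> J r = a * (r%:R ^+ 2 * ln r%:R)^-1.

Lemma log_coupling_ge0 r : (1 <= r)%N -> 0 <= J r.
Proof.
case: r => // -[//|r] _; rewrite JE //; apply/ltW/mulr_gt0 => //.
by rewrite invr_gt0 mulr_gt0 ?exprn_gt0 ?ltr0n // ln_gt0_nat.
Qed.

Lemma nneseries_bound (f : nat -> R) m B : (forall i, (m <= i)%N -> 0 <= f i) ->
  (forall n, \sum_(m <= i < n) f i <= B) -> (\sum_(m <= i <oo) (f i)%:E <= B%:E)%E.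
Proof.
move=> f0 H; apply: lime_le.
  by apply: is_cvg_nneseries => n mn _; rewrite lee_fin f0.
by apply: nearW => n; rewrite sumEFin lee_fin.
Qed.

(** The logarithm is bounded below by its value at the first term, and
    1 / q^2 <= 1 / (q - 1) - 1 / q. *)
Lemma log_coupling_tail r n : (1 <= r)%N ->
  \sum_(r.+1 <= q < n) J q <= a / (ln r.+1%:R * r%:R).
Proof.
move=> r1; have lr : 0 < ln r.+1%:R :> R by apply: ln_gt0_nat.
have rp : 0 < r%:R :> R by rewrite ltr0n.
have [nr|rn] := leqP n r.+1.
  by rewrite big_geq //; apply/ltW/divr_gt0 => //; exact: mulr_gt0.
apply: le_trans (_ : \sum_(r.+1 <= q < n) a / ln r.+1%:R * (q.-1%:R^-1 - q%:R^-1) <= _).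
  apply: ler_sum_nat => q /andP[rq _].
  have q2 : (2 <= q)%N by exact: leq_trans rq.
  have q0 : (0 < q)%N by lia.
  have qp : 0 < q%:R :> R by rewrite ltr0n.
  have qp1 : 0 < q.-1%:R :> R by rewrite ltr0n; lia.
  have lq : 0 < ln q%:R :> R by exact: ln_gt0_nat.
  rewrite JE // -mulrA; apply: ler_wpM2l; first exact: ltW.
  have qE : q%:R = q.-1%:R + 1 :> R by rewrite natr1 prednK //; lia.
  have q1q : q.-1%:R <= q%:R :> R by rewrite qE lerDl.
  have -> : q.-1%:R^-1 - q%:R^-1 = (q.-1%:R * q%:R)^-1 :> R.
    by rewrite qE; field; rewrite -qE !gt_eqF.
  rewrite -invfM lef_pV2 ?posrE ?mulr_gt0 ?exprn_gt0 // mulrC.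
  apply: ler_pM; [exact/ltW/mulr_gt0|exact: ltW| |].
    by rewrite expr2 ler_pM2r.
  by rewrite ler_ln ?posrE ?ltr0n // ler_nat.
rewrite -mulr_sumr.
have -> : \sum_(r.+1 <= q < n) ((q.-1)%:R^-1 - q%:R^-1) = r%:R^-1 - n.-1%:R^-1 :> R.
  rewrite (telescope_sumr_eq (fun i => - i.-1%:R^-1)) /= ?opprK; [|exact: ltnW|].
    by rewrite addrC.
  by move=> i _; rewrite opprK addrC.
rewrite invfM mulrA; apply: ler_wpM2l; first exact/ltW/divr_gt0.
by rewrite lerBlDr lerDl invr_ge0.
Qed.

Lemma log_coupling_sum : (\sum_(1 <= r <oo) (J r)%:E < +oo)%E.
Proof.
apply: le_lt_trans (ltry (J 1%N + a / (ln 2%:R * 1%:R))).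
apply: nneseries_bound => [|n]; first exact: log_coupling_ge0.
have [n1|n1] := leqP n 1.
  by rewrite big_geq // addr_ge0 //; apply/ltW/divr_gt0 => //; rewrite mulr_gt0 // ln_gt0_nat.
by rewrite big_ltn // lerD2l; exact: log_coupling_tail.
Qed.

(** The terms dominate the increments of [a * ln (ln r)]. *)
Lemma log_coupling_moment : (\sum_(1 <= r <oo) (r%:R * J r)%:E = +oo)%E.
Proof.
have f0 r : (1 <= r)%N -> 0 <= r%:R * J r by move=> r1; rewrite mulr_ge0 // log_coupling_ge0.
apply/eqyP => B B0; have [n0 Hn0] := ln_large (expR (B / a + ln (ln 2%:R))).
pose n := maxn n0 2.
have n2 : (2 <= n)%N by exact: leq_maxr.
apply: le_trans (_ : (\sum_(1 <= r < n) (r%:R * J r)%:E <= _)%E); last first.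
  by apply: nneseries_lim_ge => r r1 _; rewrite lee_fin f0.
rewrite sumEFin lee_fin big_ltn // -[leLHS]add0r lerD ?f0 //.
have l2 : 0 < ln 2%:R :> R by exact: ln_gt0_nat.
apply: le_trans (_ : a * (ln (ln n%:R) - ln (ln 2%:R)) <= _).
  rewrite mulrC -ler_pdivrMr // lerBrDr -[leLHS]expRK ler_ln ?posrE ?expR_gt0 //.
    by apply: Hn0; exact: leq_maxl.
  exact: ln_gt0_nat.
rewrite -(telescope_sumr (fun i => ln (ln i%:R))) // mulr_sumr.
apply: ler_sum_nat => r /andP[r2 _].
have lr : 0 < ln r%:R :> R by exact: ln_gt0_nat.
have rp : 0 < r%:R :> R by rewrite ltr0n; lia.
have -> : r%:R * J r = a * (r%:R^-1 / ln r%:R).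
  by rewrite JE //; field; rewrite !gt_eqF.
apply: ler_wpM2l; first exact: ltW.
    apply: le_trans (ln_diff lr _) _.
  by rewrite ler_ln ?posrE ?ltr0n ?ler_nat //; lia.
by apply: ler_wpM2r; [rewrite invr_ge0 ltW | apply: ln_diffS; lia].
Qed.

(** By [log_coupling_tail] the tail at [r] is at most beta a / (r log(r + 1)), which
    is eventually below 1 / (4 (r + 1)). *)
Lemma log_coupling_unique beta : 0 < beta ->
  unique_state (ising_lss (distance_coupling J) beta).
Proof.
move=> b0; pose k q := beta * J q.+1.
have k0 q : 0 <= k q := strength_ge0 log_coupling_ge0 b0 q.
have ks := strength_sum log_coupling_ge0 log_coupling_sum b0.
have kk q : 0 <= k q <= k q by rewrite k0 lexx.
have T0 r : 0 <= tail k r by exact: tail_ge0 kk.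
have [n0 Hn0] := ln_large (8 * (beta * a)).
have small r : ((maxn n0 1) <= r)%N -> 4 * tail k r <= (r.+1%:R)^-1.
  rewrite geq_max => /andP[n0r r1].
  have rp : 0 < r%:R :> R by rewrite ltr0n.
  have lr : 0 < ln r.+1%:R :> R by apply: ln_gt0_nat.
  have tr : tail k r <= beta * (a / (ln r.+1%:R * r%:R)).
    rewrite -lee_fin (EFin_tail ks _ kk); apply: nneseries_bound => // n.
    rewrite /k -mulr_sumr; apply: ler_wpM2l; first exact: ltW.
    apply: le_trans (log_coupling_tail n.+1 r1).
    by rewrite big_add1.
  have l8 : 8 * (beta * a) <= ln r.+1%:R by apply: Hn0; exact: leqW.
  apply: le_trans (_ : 4 * (beta * (a / (ln r.+1%:R * r%:R))) <= _).
    by rewrite ler_pM2l.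
  rewrite (_ : _ * _ = (8 * (beta * a)) / (ln r.+1%:R) * (2 * r%:R)^-1); last first.
    by field; rewrite !gt_eqF.
  apply: le_trans (_ : (2 * r%:R)^-1 <= _).
    by rewrite ler_piMl ?invr_ge0 ?mulr_ge0 // ler_pdivrMr // mul1r.
  rewrite lef_pV2 ?posrE ?mulr_gt0 ?ltr0n //.
  by rewrite -natrM ler_nat; lia.
apply: (@unique_state_of_renewal R (fun r => beta * J r) (tail k) (ising_field J beta)).
- exact: k0.
- by move=> r; exact: (tail_rec k0 ks).
- exact: (tail_cvg k0 ks).
- exact: (ising_field_tail log_coupling_ge0 log_coupling_sum b0).
- apply: (@renewal_divergence_of_tail _ (maxn n0 1)) => //.
  by rewrite leq_max orbT.
- exact: (ising_weightE log_coupling_ge0 log_coupling_sum b0).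
Qed.

End log_coupling.
End estimates.

Theorem mainTheorem4 (R : realType) :
  ~ kac_thompson_conjecture R /\
  forall (a : R) (J : nat -> R),
    0 < a ->
    0 <= J 1%N ->
    (forall r : nat, (2 <= r)%N -> J r = a * (r%:R ^+ 2 * ln r%:R)^-1) ->
    (\sum_(1 <= r <oo) (r%:R * J r)%:E = +oo)%E /\
    forall beta : R, 0 < beta ->
      unique_state (ising_lss (distance_coupling J) beta).
Proof.
split; last first.
  move=> a J a0 J1 JE; split; first exact: log_coupling_moment a0 J1 JE.
  by move=> beta b0; exact: log_coupling_unique a0 J1 JE _ b0.
move=> kt; pose J (r : nat) : R := 1 * (r%:R ^+ 2 * ln r%:R)^-1.
have J1 : 0 <= J 1%N by rewrite /J ln1 mulr0 invr0 mulr0.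
have JE (r : nat) : (2 <= r)%N -> J r = 1 * (r%:R ^+ 2 * ln r%:R)^-1 by [].
have [_] := kt J (log_coupling_ge0 ltr01 J1 JE) (log_coupling_sum ltr01 J1 JE).
rewrite (log_coupling_moment ltr01 J1 JE) ltxx => absurd.
suff : false by []; apply: absurd => beta b0 [mu [nu [Hmu Hnu]]]; apply.
have [rho _ Hrho] := log_coupling_unique ltr01 J1 JE b0.
by move=> A mA; rewrite -(Hrho _ Hmu A mA) -(Hrho _ Hnu A mA).
Qed.
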